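(* Let $N,K,n$ be integers with $N\geq 2$, $\kappa:=K/N\in(0,1)$ and $\eta:=n/N\in(0,1)$, let $X\sim\mathrm{Hyp}(N,K,n)$, and suppose that the mean $\mu=nK/N$ is an integer with $\mu\ge1$. Put $$a=\kappa\eta,\qquad b=\kappa(1-\eta),\qquad c=\eta(1-\kappa),\qquad d=(1-\kappa)(1-\eta).$$ Then, exactly, $$\log\frac{\mathbb E|X-\mu|}{\sqrt{2Nad/\pi}}=\int_0^\infty\varphi(t)\,\Delta_N(t)\,dt,$$ with $$\Delta_N(t)=e^{-Kt}+e^{-(N-K)t}+e^{-nt}+e^{-(N-n)t}-\Bigl[e^{-Nat}+e^{-Nbt}+e^{-Nct}+e^{-Ndt}+e^{-Nt}\Bigr],$$ and $\Delta_N(t)<0$ for every $t>0$. For $m\ge1$ let $W_m=\kappa^{-m}+(1-\kappa)^{-m}+\eta^{-m}+(1-\eta)^{-m}$, $\widehat\Xi_m=(a^{-m}+d^{-m})+(-1)^{m+1}(b^{-m}+c^{-m})$ and $$\tilde a_m(h)=\frac{(-1)^{m+1}}{m(m+1)}\Bigl[(W_m-1)\,B_{m+1}-\widehat\Xi_m\,B_{m+1}(h)\Bigr]$$ (the coefficients of the asymptotic series $\sum_{m\ge1}\tilde a_m(h)N^{-m}$ of $\log\bigl(\mathbb E|X-\mu|/\sqrt{2Nad/\pi}\bigr)$, with $h=\lceil\mu\rceil-\mu$). At $h=0$ this series collapses to an odd series, i.e. $\tilde a_{2j}(0)=0$ for all $j\ge1$, with $$\tilde a_{2j-1}(0)=\frac{B_{2j}}{(2j-1)\,2j}\Bigl[W_{2j-1}-1-\bigl(a^{1-2j}+b^{1-2j}+c^{1-2j}+d^{1-2j}\bigr)\Bigr],\qquad(-1)^j\,\tilde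 a_{2j-1}(0)>0\qquad(j\ge1),$$ and its successive partial sums strictly bracket the logarithm above: for every integer $M\ge0$, $$(-1)^{M+1}\Bigl[\log\frac{\mathbb E|X-\mu|}{\sqrt{2Nad/\pi}}-\sum_{j=1}^{M}\frac{\tilde a_{2j-1}(0)}{N^{2j-1}}\Bigr]>0 .$$
   Context: $B_k(t)$ and $B_k=B_k(0)$ are the Bernoulli polynomials and numbers: $\frac{z e^{tz}}{e^z-1}=\sum_{k\ge0}B_k(t)\frac{z^k}{k!}$. $\mathrm{Hyp}(N,K,n)$ has mass function $P(k)=\binom Kk\binom{N-K}{n-k}/\binom Nn$, with $\binom{m}{j}=0$ for $j<0$ or $j>m$. The function $\varphi$ is $\varphi(t)=\frac1t\bigl(\frac1{e^t-1}-\frac1t+\frac12\bigr)$, $t>0$. *)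

(* Defs.v *)
From HB Require Import structures.
From mathcomp Require Import all_boot all_order all_algebra.
From mathcomp Require Import all_classical all_reals all_analysis.

Set Implicit Arguments.
Unset Strict Implicit.
Unset Printing Implicit Defensive.

Import Order.TTheory GRing.Theory Num.Theory.
Import numFieldNormedType.Exports.

Local Open Scope classical_set_scope.
Local Open Scope ring_scope.

(* [B k t] is the value at [t] of the k-th Bernoulli polynomial, and [B k 0] is
   the k-th Bernoulli number: z e^(tz) / (e^z - 1) = \sum_k B_k(t) z^k / k! for
   all small nonzero z.  The coefficients of a convergent power series are
   determined by its sum, so at most one [B] qualifies; [bernoulli_exists]
   below shows that there is one. *)
Definition is_bernoulli (R : realType) (B : nat -> R -> R) : Prop :=
  forall t : R, \forall z \near 0^',
    pseries (fun k => B k t / k`!%:R) z @ \oo -->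
      z * expR (t * z) / (expR z - 1).

(* 'C(m, j) for an integer j, equal to 0 when j < 0; the library's 'C(m, j)
   is already 0 when j > m. *)
Definition binz (m : nat) (j : int) : nat :=
  if j is Posz i then 'C(m, i) else 0%N.

Definition hyp_pmf (R : realType) (N K n : nat) (k : int) : R :=
  (binz K k)%:R * (binz (N - K) (n%:Z - k))%:R / 'C(N, n)%:R.

Definition hypergeometric (R : realType) (d : measure_display)
    (T : measurableType d) (P : probability T R) (X : {RV P >-> R})
    (N K n : nat) : Prop :=
  forall k : int, pmf X k%:~R = hyp_pmf R N K n k.

Section functions.
Variable R : realType.

Definition phi (t : R) : R := t^-1 * ((expR t - 1)^-1 - t^-1 + 2^-1).

Definition Delta (N K n : nat) (t : R) : R :=
  let kappa := K%:R / N%:R in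
  let eta := n%:R / N%:R in
  let a : R := kappa * eta in
  let b : R := kappa * (1 - eta) in
  let c : R := eta * (1 - kappa) in
  let d : R := (1 - kappa) * (1 - eta) in
  expR (- (K%:R * t)) + expR (- ((N%:R - K%:R) * t))
  + expR (- (n%:R * t)) + expR (- ((N%:R - n%:R) * t))
  - (expR (- (N%:R * a * t)) + expR (- (N%:R * b * t))
     + expR (- (N%:R * c * t)) + expR (- (N%:R * d * t))
     + expR (- (N%:R * t))).

Definition W (kappa eta : R) (m : nat) : R :=
  kappa ^- m + (1 - kappa) ^- m + eta ^- m + (1 - eta) ^- m.

Definition Xihat (kappa eta : R) (m : nat) : R :=
  let a : R := kappa * eta in
  let b : R := kappa * (1 - eta) in
  let c : R := eta * (1 - kappa) in
  let d : R := (1 - kappa) * (1 - eta) in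
  (a ^- m + d ^- m) + (-1) ^+ m.+1 * (b ^- m + c ^- m).

Definition atilde (B : nat -> R -> R) (kappa eta : R) (m : nat) (h : R) : R :=
  (-1) ^+ m.+1 / (m * m.+1)%:R *
  ((W kappa eta m - 1) * B m.+1 0 - Xihat kappa eta m * B m.+1 h).

End functions.

Section existence.
Variable R : realType.
Implicit Types (t z : R) (u v : nat -> R).

Let series_norm_le u (C q : R) (m n : nat) : 0 <= C -> 0 <= q <= 1 ->
  (forall k, `|u k| <= C * q ^+ k) -> (m <= n)%N ->
  `|series u n - series u m| <= (n - m)%:R * (C * q ^+ m).
Proof.
move=> C0 /andP[q0 q1] hu mn; rewrite sub_series mn.
rewrite (le_trans (ler_norm_sum _ _ _))//.
have -> : (n - m)%:R * (C * q ^+ m) = \sum_(m <= k < n) C * q ^+ m.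
  by rewrite sumr_const_nat mulr_natl.
apply: ler_sum_nat => k /andP[mk _]; apply: (le_trans (hu k)).
by rewrite ler_wpM2l// ler_wiXn2l.
Qed.

Let conv u v k : R := \sum_(i < k.+1) u i * v (k - i)%N.

Let series_conv u v n :
  series (conv u v) n = \sum_(i < n) u i * series v (n - i)%N.
Proof.
elim: n => [|n IH]; first by rewrite /series/= big_nil big_ord0.
rewrite seriesSr IH /conv big_ord_recr/= [RHS]big_ord_recr/= addrA -big_split/=.
congr (_ + _).
  apply: eq_bigr => i _; rewrite subSn; last exact: ltnW.
  by rewrite seriesSr mulrDr.
by rewrite subnn subSnn seriesSr /series/= big_nil add0r.
Qed.

Let cauchy_product u v (C q U V : R) : 0 <= C -> 0 <= q <= 8^-1 ->
  (forall k, `|u k| <= C * q ^+ k) -> (forall k, `|v k| <= C * q ^+ k) ->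
  series u @ \oo --> U -> series v @ \oo --> V ->
  series (conv u v) @ \oo --> U * V.
Proof.
move=> C0 /andP[q0 q8] hu hv uU vV.
have q1 : 0 <= q <= 1 by rewrite q0 (le_trans q8)// invf_le1// ler1n.
have bnd n : `|series u n * series v n - series (conv u v) n|
    <= C ^+ 2 * 2^-1 ^+ n.
  rewrite series_conv {1}/series/= big_mkord mulr_suml -sumrB.
  rewrite (le_trans (ler_norm_sum _ _ _))//.
  apply: (@le_trans _ _ (\sum_(i < n) C ^+ 2 * (n%:R * q ^+ n))).
    apply: ler_sum => i _; rewrite -mulrBr normrM.
    have := series_norm_le C0 q1 hv (leq_subr i n).
    rewrite subKn; last exact: ltnW.
    move=> h; apply: (le_trans (ler_pM _ _ (hu i) h)) => //.
    have -> : C * q ^+ i * (i%:R * (C * q ^+ (n - i))) =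
        C ^+ 2 * (i%:R * (q ^+ i * q ^+ (n - i))).
      rewrite expr2 -!mulrA; congr (_ * _).
      by rewrite mulrCA [in RHS]mulrCA; congr (_ * _); rewrite mulrCA.
    rewrite -exprD subnKC; last exact: ltnW.
    rewrite ler_wpM2l ?exprn_ge0// ler_wpM2r ?exprn_ge0//.
    by rewrite ler_nat ltnW.
  rewrite sumr_const card_ord -mulrnAr ler_wpM2l ?exprn_ge0//.
  rewrite -mulr_natl mulrA -natrM.
  apply: (@le_trans _ _ ((2 ^ n * 2 ^ n)%:R * 8^-1 ^+ n)).
    apply: ler_pM => //; rewrite ?exprn_ge0//.
      by rewrite ler_nat leq_mul// ltnW// ltn_expl.
    by rewrite lerXn2r// nnegrE invr_ge0.
  rewrite -expnMn natrX -exprMn.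
  rewrite (_ : (2 * 2)%:R * 8^-1 = 2^-1 :> R)//.
  have -> : (8 : R) = (2 * 2)%:R * 2 by rewrite -!natrM.
  by rewrite invfM mulrA divff ?mul1r// pnatr_eq0.
have uvUV : series u n * series v n @[n --> \oo] --> U * V by exact: cvgM.
have D0 : series u n * series v n - series (conv u v) n @[n --> \oo] --> (0 : R).
  apply: norm_cvg0.
  apply: (squeeze_cvgr (f := fun=> 0) (h := fun n => C ^+ 2 * 2^-1 ^+ n)).
  - by near=> n; rewrite normr_ge0 bnd.
  - exact: cvg_cst.
  - rewrite -(mulr0 (C ^+ 2)); apply: cvgM; first exact: cvg_cst.
    by apply: cvg_expr; rewrite ger0_norm ?invr_ge0// invf_lt1// ltr1n.
rewrite (_ : series (conv u v) = fun n => series u n * series v n -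
    (series u n * series v n - series (conv u v) n)).
  by rewrite -(subr0 (U * V)); exact: cvgB.
by apply/funext => n; rewrite subKr.
Unshelve. all: by end_near.
Qed.

Let coefs t := fix coefs n : seq R := if n is m.+1 then
  rcons (coefs m) (t ^+ m / m`!%:R -
    \sum_(i < m) (coefs m)`_i / (m - i).+1`!%:R) else [::].

Let coef t n := (coefs t n.+1)`_n.

Let size_coefs t n : size (coefs t n) = n.
Proof. by elim: n => //= n IH; rewrite size_rcons IH. Qed.

Let nth_coefs t n i : (i < n)%N -> (coefs t n)`_i = coef t i.
Proof.
elim: n => // n IH; rewrite ltnS leq_eqVlt => /orP[/eqP ->//|lin].
by rewrite /= nth_rcons size_coefs lin IH.
Qed.

Let coefE t n :
  coef t n = t ^+ n / n`!%:R - \sum_(i < n) coef t i / (n - i).+1`!%:R.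
Proof.
rewrite {1}/coef/= nth_rcons size_coefs ltnn eqxx; congr (_ - _).
by apply: eq_bigr => i _; rewrite nth_coefs.
Qed.

Let coef_conv t n :
  \sum_(i < n.+1) coef t i / (n - i).+1`!%:R = t ^+ n / n`!%:R.
Proof. by rewrite big_ord_recr/= subnn divr1 [X in _ + X]coefE addrC subrK. Qed.

Let fact_ge_exp k : (2 ^ k <= k.+1`!)%N.
Proof.
elim: k => // k IH; rewrite factS expnS leq_mul//.
Qed.

Let geom_le (r : R) n : 2 <= r ->
  \sum_(i < n) r ^+ i * 2^-1 ^+ (n - i) <= 2^-1 * r ^+ n.
Proof.
move=> r2; elim: n => [|n IH].
  by rewrite big_ord0 mulr1 invr_ge0.
have r0 : 0 <= r by rewrite (le_trans _ r2).
rewrite big_ord_recr/= subSnn expr1.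
under eq_bigr => i _ do
  rewrite (subSn (ltnW (ltn_ord i))) exprS mulrCA.
rewrite -mulr_sumr.
apply: (@le_trans _ _ (2^-1 * (2^-1 * r ^+ n) + r ^+ n * 2^-1)).
  by rewrite lerD2r ler_wpM2l// invr_ge0.
rewrite exprS (mulrC (r ^+ n)) -mulrDr ler_wpM2l ?invr_ge0//.
rewrite -{2}(mul1r (r ^+ n)) -mulrDl ler_wpM2r ?exprn_ge0//.
rewrite (le_trans _ r2)// -[leRHS]/(1 + 1) lerD2r.
by rewrite invf_le1// ler1n.
Qed.

Let coef_le t n : `|coef t n| <= 2 * (2 + `|t|) ^+ n.
Proof.
set r := 2 + `|t|; have r2 : 2 <= r by rewrite lerDl.
have r0 : 0 <= r by rewrite (le_trans _ r2).
elim/ltn_ind: n => n IH; rewrite coefE (le_trans (ler_normB _ _))//.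
rewrite (_ : 2 * r ^+ n = r ^+ n + r ^+ n); last by rewrite mulr_natl mulr2n.
apply: lerD.
  rewrite normrM normfV normrX (@ger0_norm _ n`!%:R)//.
  rewrite -[leRHS]mulr1 ler_pM// ?exprn_ge0// ?invr_ge0//.
    by rewrite lerXn2r// ?nnegrE// lerDr.
  by rewrite invf_le1 ?ltr0n ?fact_gt0// ler1n fact_gt0.
rewrite (le_trans (ler_norm_sum _ _ _))//.
apply: (@le_trans _ _ (\sum_(i < n) 2 * (r ^+ i * 2^-1 ^+ (n - i)))).
  apply: ler_sum => i _; rewrite normrM normfV (@ger0_norm _ (_`!)%:R)// mulrA.
  apply: ler_pM; rewrite ?invr_ge0//; first exact: IH.
  rewrite exprVn lef_pV2 ?posrE ?exprn_gt0 ?ltr0n ?fact_gt0//.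
  by rewrite -natrX ler_nat fact_ge_exp.
rewrite -mulr_sumr; apply: (le_trans (ler_wpM2l _ (geom_le n r2))) => //.
by rewrite mulrA divff ?mul1r.
Qed.

Lemma bernoulli_exists : exists B : nat -> R -> R, is_bernoulli B.
Proof.
exists (fun k t => k`!%:R * coef t k) => t.
set r := 2 + `|t|; have r2 : 2 <= r by rewrite lerDl.
have r0 : 0 < r by rewrite (lt_le_trans _ r2).
near=> z.
have z0 : z != 0 by near: z; exact: nbhs_dnbhs_neq.
have zr : `|z| <= (8 * r)^-1.
  near: z; apply: dnbhs0_le.
  by rewrite invr_gt0 mulr_gt0.
rewrite /pseries.
pose u k := coef t k * z ^+ k.
pose v k := z ^+ k / k.+1`!%:R.
have -> : [series k`!%:R * coef t k / k`!%:R * z ^+ k]_k = series u.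
  congr series; apply/funext => k; rewrite /u/=; congr (_ * _).
  by rewrite mulrAC divff ?mul1r.
have e0 : expR z - 1 != 0 by rewrite subr_eq0 -expR0 (inj_eq (@expR_inj R)).
have z8 : `|z| <= 8^-1.
  rewrite (le_trans zr)// lef_pV2 ?posrE// ?mulr_gt0// ler_peMr//.
  by rewrite (le_trans _ r2)// ler1n.
have u_le k : `|u k| <= 2 * (r * `|z|) ^+ k.
  by rewrite /u normrM normrX exprMn mulrA ler_wpM2r ?exprn_ge0// coef_le.
have rz8 : r * `|z| <= 8^-1.
  by rewrite -ler_pdivlMl// mulrC -invfM.
have v_le k : `|v k| <= 2 * (r * `|z|) ^+ k.
  rewrite /v normrM normfV (@ger0_norm _ (_`!)%:R)// normrX.
  rewrite mulrC ler_pM// ?invr_ge0//.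
    apply: (@le_trans _ _ 1); last by rewrite ler1n.
    by rewrite invf_le1 ?ltr0n ?fact_gt0// ler1n fact_gt0.
  rewrite lerXn2r ?nnegrE// ?mulr_ge0 ?(ltW r0)//.
  by rewrite ler_peMl// (le_trans _ r2)// ler1n.
have cu : cvgn (series u).
  apply: normed_cvg; apply: (@series_le_cvg _ _ (geometric 2 (r * `|z|))).
  - by move=> k /=.
  - by move=> k /=; rewrite mulr_ge0// exprn_ge0// mulr_ge0// ltW.
  - exact: u_le.
  - apply: is_cvg_geometric_series; rewrite ger0_norm ?mulr_ge0 ?(ltW r0)//.
    by rewrite (le_lt_trans rz8)// invf_lt1// ltr1n.
have expz (y : R) : series (exp_coeff y) @ \oo --> expR y.
  exact: is_cvg_series_exp_coeff.
have cv : series v @ \oo --> (expR z - 1) / z.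
  have vE : series v = fun n => (series (exp_coeff z) n.+1 - 1) / z.
    apply/funext => n; apply: (mulIf z0); rewrite divfK//.
    rewrite /series/= big_nat_recl//= /exp_coeff/= expr0 divr1 addrC addKr.
    rewrite mulr_suml; apply: eq_bigr => k _.
    by rewrite /v exprSr mulrAC.
  rewrite vE; apply: cvgM; last exact: cvg_cst.
  apply: cvgB; last exact: cvg_cst.
  by have := expz z; rewrite -(cvg_shiftS (series (exp_coeff z))).
have := cauchy_product (ler0n _ 2) _ u_le v_le cu cv.
have -> : conv u v = exp_coeff (t * z).
  apply/funext => k; rewrite /exp_coeff/= exprMn mulrAC -coef_conv mulr_suml.
  apply: eq_bigr => i _; rewrite /u /v mulrA -(mulrA (coef t i)) -exprD subnKC -1?ltnS//.
  by rewrite mulrAC.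
rewrite rz8 mulr_ge0 ?(ltW r0)// => /(_ isT) /cvg_unique /(_ (expz (t * z))).
move=> /(_ (@norm_hausdorff _ _)) h.
suff -> : z * expR (t * z) / (expR z - 1) = limn (series u) by [].
by rewrite -h mulrCA [_ / z]mulrC mulVKf// mulfK.
Unshelve. all: by end_near.
Qed.

End existence.

(* Main.v *)
(** The mean absolute deviation telescopes (de Moivre) to [2 p s / N * P(mu)],
    where [p, q, r, s] are the cells [Na, Nb, Nc, Nd] of the two by two table.
    Inserting Binet's form of Stirling's formula for the nine factorials, with
    error term the Laplace transform [theta] of [phi], everything cancels but
    the thetas, which gives the integral of [phi * Delta].

    Binet's formula is obtained from the increments of [theta] (Tonelli) and
    from Wallis' product for the constant.  The Taylor polynomials of [phi]
    alternately bound it from above and below, because the remainder of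
    [t exp(x t) / (exp t - 1)], as a function of [x], has an explicit derivative
    whose sign on [(0, 1/2)] is that of an odd Bernoulli polynomial.  As
    [Delta < 0], integrating these bounds against [Delta] brackets the logarithm. *)
Require Import Defs.
From HB Require Import structures.
From mathcomp Require Import all_boot all_order all_algebra.
From mathcomp Require Import all_classical all_reals all_analysis.
From mathcomp Require Import measurable_realfun ring lra zify.

Set Implicit Arguments.
Unset Strict Implicit.
Unset Printing Implicit Defensive.

Import Order.TTheory GRing.Theory Num.Theory.
Import numFieldNormedType.Exports.

Local Open Scope classical_set_scope.
Local Open Scope ring_scope.

(** An integer mean makes the four cells integers, hence arguments of factorials. The argument then
    runs through one linear functional, [cell_sum]: it sums a function over the four margins of the
    table and subtracts it over the four cells and the total. On exp(-l t) it gives [Delta], on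
    [theta] the logarithm, and on the Laplace transforms of the Taylor terms of [phi] the summands
    [atilde / N^m]. Hence the logarithm minus a partial sum is exactly the integral of a Taylor
    remainder of [phi] against [Delta].

    The Taylor series of [phi] converges only for |t| < 2 pi while the integrals run over all t > 0,
    so the remainder needs a sign for every t > 0; an exact formula for truncations provides it.

    [B] is given only by its generating function near 0, which shows no signs. A second family
    [bern] is therefore built from rules on derivatives and end values, and its values at 0 are
    identified with those of [B] by comparing truncations for small z > 0. *)

Lemma mean_value (R : realType) (f df : R -> R) (a b : R) : a < b ->
  (forall x, a <= x <= b -> is_derive x 1 f (df x)) ->
  exists2 c, a < c < b & f b - f a = df c * (b - a).
Proof.
move=> ab fdf.
have [] := @MVT R f df a b ab.
- by move=> x; rewrite in_itv/= => /andP[ax xb]; apply: fdf; rewrite !ltW.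
- apply: derivable_within_continuous => x; rewrite in_itv/= => xab.
  by have [] := fdf _ xab.
- by move=> c; rewrite in_itv/=; exists c.
Qed.

(** A nonnegative interior value would make [f1] nonnegative at some point and nonpositive at a
    later one, so that [f2] would be nonpositive somewhere in between. *)
Lemma convex_zero_ends_lt0 (R : realType) (f f1 f2 : R -> R) (a b : R) :
  (forall x, a <= x <= b -> is_derive x 1 f (f1 x)) ->
  (forall x, a <= x <= b -> is_derive x 1 f1 (f2 x)) ->
  (forall x, a < x < b -> 0 < f2 x) -> f a = 0 -> f b = 0 ->
  forall x, a < x < b -> f x < 0.
Proof.
move=> d1 d2 f2_gt0 fa fb x /andP[ax xb]; rewrite ltNge; apply/negP => fx.
have [|c1 /andP[ac1 c1x] e1] := @mean_value R f f1 a x ax.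
  by move=> y /andP[ay yx]; apply: d1; rewrite ay (le_trans yx (ltW xb)).
have [|c2 /andP[xc2 c2b] e2] := @mean_value R f f1 x b xb.
  by move=> y /andP[ay yx]; apply: d1; rewrite yx (le_trans (ltW ax) ay).
have c12 : c1 < c2 by apply: lt_trans xc2.
have [|c3 /andP[c13 c32] e3] := @mean_value R f1 f2 c1 c2 c12.
  by move=> y /andP[ay yx]; apply: d2; apply/andP; split; lra.
have : 0 < f2 c3 by apply: f2_gt0; apply/andP; split; lra.
have : 0 <= f1 c1.
  by rewrite -(@pmulr_lge0 _ (x - a)) ?subr_gt0// mulrC mulrC -e1 fa subr0.
have : f1 c2 <= 0.
  by rewrite -(@pmulr_lle0 _ (b - x)) ?subr_gt0// mulrC mulrC -e2 fb; lra.
by move: e3 c12; nra.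
Qed.

(** * Bernoulli polynomials *)

Section bernoulli_polynomials.
Variable R : realType.
Implicit Types (p q : {poly R}) (x : R).

Definition primitive p : {poly R} :=
  \poly_(i < (size p).+1) (p`_i.-1 / i%:R *+ (0 < i)%N).

Lemma deriv_primitive p : (primitive p)^`() = p.
Proof.
apply/polyP => i; rewrite coef_deriv coef_poly ltnS.
case: ltnP => [_|/(nth_default 0) ->]; last by rewrite mul0rn.
by rewrite /= mulr1n -[LHS]mulr_natr mulfVK// pnatr_eq0.
Qed.

(* [bern k] is [B_k(x) / k!], normalized so that differentiation lowers the
   index. *)
Fixpoint bern k : {poly R} := if k is j.+1 then
  primitive (bern j) - (primitive (primitive (bern j))).[1]%:P +
  (primitive (primitive (bern j))).[0]%:P else 1.

Lemma bern0_horner x : (bern 0).[x] = 1.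
Proof. by rewrite -[bern 0]/1%:P hornerC. Qed.

Lemma deriv_bern k : (bern k.+1)^`() = bern k.
Proof. by rewrite /= !poly.derivE deriv_primitive subr0 addr0. Qed.

Lemma deriv_eq0 p : p^`() = 0 -> p = (p.[0])%:P.
Proof.
move=> p0; apply/polyP => -[|i]; first by rewrite horner_coef0 coefC eqxx.
have /eqP := congr1 (fun q : {poly R} => q`_i) p0.
by rewrite coef_deriv coef0 mulrn_eq0/= coefC => /eqP.
Qed.

Lemma deriv_inj p q : p^`() = q^`() -> p = q + (p.[0] - q.[0])%:P.
Proof.
move=> pq; have /deriv_eq0 : (p - q)^`() = 0 by rewrite derivB pq subrr.
by rewrite hornerD hornerN => <-; rewrite addrC subrK.
Qed.

(** The constant in [bern k.+1] gives it integral zero over the unit interval, so its primitives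
    agree at 0 and 1. The primitive used is [PP] minus its chord slope times X, with [PP] a second
    primitive of [bern k]. *)
Lemma bern_ends k : (bern k.+2).[1] = (bern k.+2).[0].
Proof.
have := deriv_inj (etrans (deriv_bern k.+1) (esym (etrans _ (erefl (bern k.+1))))).
set P := primitive (bern k).
set PP := primitive P; move=> /(_ (PP - (PP.[1] - PP.[0])%:P * 'X)).
have -> : (PP - (PP.[1] - PP.[0])%:P * 'X)^`() = bern k.+1.
  rewrite derivB deriv_primitive mul_polyC derivZ derivX alg_polyC /= -/P -/PP.
  by rewrite polyCB opprB addrA addrAC.
move=> /(_ erefl) h; rewrite [in LHS]h.
move: (bern k.+2) PP {h} => b Q.
by rewrite !(hornerD, hornerN, hornerM, hornerX, hornerC); ring.
Qed.

(** When [e k] is zero, [e k.+1] is a constant c and [e k.+2] is c X plus a constant; equal end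
    values force c = 0. *)
Lemma bern_unique (e : nat -> {poly R}) : e 0%N = 0 ->
  (forall k, (e k.+1)^`() = e k) -> (forall k, (e k.+2).[1] = (e k.+2).[0]) ->
  forall k, e k = 0.
Proof.
move=> e0 ed ee; elim=> // k IH.
have e1 := deriv_eq0 (etrans (ed k) IH).
have /deriv_inj : (e k.+2)^`() = ((e k.+1).[0]%:P * 'X)^`().
  by rewrite ed mul_polyC derivZ derivX alg_polyC.
move=> /(congr1 (horner^~ 1)).
rewrite !(hornerD, hornerN, hornerM, hornerX, hornerC) ee => h.
have c0 : (e k.+1).[0] = 0 by lra.
by rewrite e1 c0.
Qed.

Lemma bern_sym k : bern k \Po (1 - 'X) = (-1) ^+ k *: bern k.
Proof.
pose e k := bern k \Po (1 - 'X) - (-1) ^+ k *: bern k.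
(* Differentiating a composition with 1 - X costs a minus sign; the factor (-1)^k absorbs it, so
   that [bern_unique] applies to [f]. *)
pose f k := (-1) ^+ k *: e k.
suff : f k = 0.
  move=> /eqP; rewrite /f scaler_eq0 signr_eq0/= subr_eq0; exact: eqP.
apply: bern_unique => {k} => [|k|k].
- by rewrite /f /e /= comp_polyC !expr0 !scale1r subrr.
- rewrite /f derivZ /e derivB derivZ deriv_comp !deriv_bern !poly.derivE sub0r.
  by rewrite exprS mulN1r mulrN1 !scaleNr -scalerN opprD !opprK.
- rewrite /f /e; move: (bern k.+2) (bern_ends k) => b bE.
  by rewrite !(hornerE, horner_comp) subrr subr0 bE.
Qed.

Lemma bern_sym_horner k x : (bern k).[1 - x] = (-1) ^+ k * (bern k).[x].
Proof.
by rewrite -hornerZ -bern_sym horner_comp !hornerE.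
Qed.

Lemma bern_odd0 M : (bern M.*2.+3).[0] = 0.
Proof.
have := bern_sym_horner M.*2.+3 0; rewrite subr0 bern_ends -signr_odd/=.
by rewrite odd_double/= expr1; lra.
Qed.

Lemma bern_odd_half M : (bern M.*2.+1).[2^-1] = 0.
Proof.
have := bern_sym_horner M.*2.+1 2^-1; rewrite -signr_odd/= odd_double/= expr1.
by rewrite (_ : 1 - 2^-1 = 2^-1 :> R); lra.
Qed.

(** From index 3 on the polynomial vanishes at 0 and 1/2, and its second derivative is the preceding
    odd one, of constant sign by induction; convexity gives the opposite sign. The base case is x -
    1/2. *)
Lemma bern_odd_sign M x : 0 < x < 2^-1 ->
  0 < (-1) ^+ M.+1 * (bern M.*2.+1).[x].
Proof.
elim: M x => [|M IH] x x01.
  have : (bern 1).[2^-1] = 0 by exact: (bern_odd_half 0).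
  have [] := @mean_value R (horner (bern 1)) (fun=> 1) x 2^-1.
  - by case/andP: x01.
  - move=> y _; have := is_derive_poly (bern 1) y.
    by rewrite deriv_bern -[bern 0]/1%:P hornerC.
  - by move=> c _ /= h1 h2; case/andP: x01; rewrite expr1; lra.
pose s : R := (-1) ^+ M.+1.
have sE : (-1) ^+ M.+2 = - s by rewrite exprS mulN1r.
rewrite sE mulNr oppr_gt0.
have hd k (y : R) : is_derive y (1 : R) (fun y : R => s * (bern k.+1).[y]) (s * (bern k).[y]).
  have := is_derive_poly (s *: bern k.+1) y.
  rewrite derivZ deriv_bern hornerZ; congr is_derive.
  by apply/funext => z; rewrite hornerZ.
apply: (@convex_zero_ends_lt0 R (fun y => s * (bern M.*2.+3).[y])
  (fun y => s * (bern M.*2.+2).[y]) (fun y => s * (bern M.*2.+1).[y]) 0 2^-1) => //.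
- by rewrite /= bern_odd0 mulr0.
- by rewrite -[M.*2.+3]/(M.+1.*2.+1) bern_odd_half mulr0.
Qed.

End bernoulli_polynomials.

Arguments bern {R} k : simpl never.

(** * Alternating bounds on [phi] *)

Section bernoulli_remainder.
Variable R : realType.
Implicit Types (t x : R) (M m k : nat).

Local Notation bern := (@bern R).

Lemma bern1_ends : (bern 1).[1] = (bern 1).[0] + 1.
Proof.
have /deriv_inj : (bern 1)^`() = ('X : {poly R})^`() by rewrite deriv_bern derivX.
move=> /(congr1 (horner^~ 1)).
rewrite !(hornerD, hornerN, hornerX, hornerC) => ->; ring.
Qed.

Lemma bern1_0 : (bern 1).[0] = - 2^-1.
Proof. by have := bern_sym_horner 1 (0 : R); rewrite subr0 bern1_ends expr1; lra. Qed.

(** Truncation in powers of t of the generating function t exp(x t) / (exp t - 1), seen as a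
    polynomial in x. *)
Definition bern_sum m t : {poly R} := \sum_(k < m.+1) t ^+ k *: bern k.

(** The full generating function G satisfies G' = t G in x; truncation leaves a single defect, the
    last term. Multiplying by exp(-t x) then gives a product as derivative. *)
Lemma deriv_bern_sum m t :
  (bern_sum m t)^`() = t *: bern_sum m t - t ^+ m.+1 *: bern m.
Proof.
elim: m => [|m IH].
  by rewrite /bern_sum big_ord1 derivZ derivC scaler0 expr0 expr1 scale1r subrr.
rewrite /bern_sum big_ord_recr/= -/(bern_sum m t) derivD IH derivZ deriv_bern.
by rewrite subrK scalerDr scalerA -exprS addrK.
Qed.

Lemma bern_sum_ends m t : (bern_sum m.+1 t).[1] = (bern_sum m.+1 t).[0] + t.
Proof.
elim: m => [|m IH].
  rewrite /bern_sum !big_ord_recr !big_ord0/= !add0r !hornerD !hornerZ.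
  by rewrite !bern0_horner bern1_ends expr1; ring.
rewrite /bern_sum big_ord_recr/= -/(bern_sum m.+1 t) hornerD IH hornerD !hornerZ.
by rewrite bern_ends; ring.
Qed.

Lemma is_derive_exp_bern_sum m t x :
  is_derive x 1 (fun y : R => expR (- (t * y)) * (bern_sum m t).[y])
    (- (t ^+ m.+1 * (expR (- (t * x)) * (bern m).[x]))).
Proof.
have h1 : is_derive x 1 (fun y : R => expR (- (t * y))) (- t * expR (- (t * x))).
  apply: trigger_derive; rewrite /GRing.scale/=; ring.
have h2 := is_derive_poly (bern_sum m t) x.
apply: (trigger_derive (is_deriveM h1 h2)); rewrite /GRing.scale/= deriv_bern_sum.
rewrite hornerD hornerN !hornerZ; ring.
Qed.

(** The mean value theorem is applied to g(y) = f(y) - f(1 - y) on (0, 1/2), not to [f] on (0, 1):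
    [bern m] changes sign at 1/2, and folding replaces it by [bern m] at a point c < 1/2 times
    exp(-t c) - exp(-t (1 - c)) > 0. Here g(1/2) = 0 and -g(0) is the remainder times 1 -
    exp(-t). *)
Lemma bern_remainder_sign M t : 0 < t ->
  0 < (-1) ^+ M * (t / (expR t - 1) - \sum_(k < M.*2.+2) (bern k).[0] * t ^+ k).
Proof.
move=> t0; set m := M.*2.+1.
have -> : \sum_(k < m.+1) (bern k).[0] * t ^+ k = (bern_sum m t).[0].
  by rewrite /bern_sum horner_sum; apply: eq_bigr => k _; rewrite hornerZ mulrC.
pose f (y : R) := expR (- (t * y)) * (bern_sum m t).[y].
pose f' (y : R) := - (t ^+ m.+1 * (expR (- (t * y)) * (bern m).[y])).
have df (y : R) : is_derive y (1 : R) f (f' y) by exact: is_derive_exp_bern_sum.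
have dg (y : R) : is_derive y (1 : R) (fun y => f y - f (1 - y)) (f' y + f' (1 - y)).
  have dh : is_derive y (1 : R) (fun y => 1 - y) (-1 : R).
    by apply: trigger_derive; rewrite /GRing.scale/=; ring.
  have dc : is_derive y (1 : R) (fun z : R => f (1 - z)) (f' (1 - y) * -1).
    exact: (@is_derive1_comp R f (fun z : R => 1 - z) y _ _ (df (1 - y)) dh).
  by apply: (trigger_derive (is_deriveB (df y) dc)); rewrite /GRing.scale/=; ring.
have [|c /andP[c0 c2]] := @mean_value R _ _ 0 2^-1 _ (fun y _ => dg y).
  by rewrite invr_gt0.
have -> : 1 - 2^-1 = 2^-1 :> R by lra.
rewrite subrr sub0r !subr0 /f mulr0 oppr0 expR0 mul1r mulr1.
rewrite bern_sum_ends /f' bern_sym_horner.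
have -> : (-1) ^+ m = -1 :> R by rewrite -signr_odd/= odd_double.
have c02 : 0 < c < 2^-1 by rewrite c0.
have := @bern_odd_sign R M c c02; rewrite -/m exprS mulN1r mulNr oppr_gt0.
set s := (-1) ^+ M; set b := (bern m).[c]; set S := (bern_sum m t).[0] => sb eq1.
have ee : expR (- (t * (1 - c))) < expR (- (t * c)).
  by rewrite ltr_expR ltrN2 ltr_pM2l//; lra.
have tm : 0 < t ^+ m.+1 by rewrite exprn_gt0.
have e1 : 0 < expR t - 1 by rewrite subr_gt0 -expR0 ltr_expR.
have et : 0 < expR t by exact: expR_gt0.
have : 0 < s * (t - S * (expR t - 1)).
  have -> : t - S * (expR t - 1) = - ((S - expR (- t) * (S + t)) * expR t).
    by rewrite mulrBl mulrAC -expRD addNr expR0; ring.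
  have -> : S - expR (- t) * (S + t) =
     t ^+ m.+1 * (expR (- (t * c)) - expR (- (t * (1 - c)))) * b / 2.
    by move: eq1; rewrite -!mulrA mulN1r; lra.
  have pp : 0 < t ^+ m.+1 * (expR (- (t * c)) - expR (- (t * (1 - c)))) * expR t / 2.
    by rewrite divr_gt0// mulr_gt0// mulr_gt0// subr_gt0.
  rewrite (_ : s * _ = (- (s * b)) *
      (t ^+ m.+1 * (expR (- (t * c)) - expR (- (t * (1 - c)))) * expR t / 2));
    last by ring.
  by rewrite mulr_gt0// oppr_gt0.
have -> : t - S * (expR t - 1) = (t / (expR t - 1) - S) * (expR t - 1).
  by rewrite mulrBl divfK// gt_eqF.
by rewrite mulrA pmulr_lgt0.
Qed.

Lemma bern_sum_even M t : \sum_(k < M.*2.+2) (bern k).[0] * t ^+ k =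
  1 - t / 2 + \sum_(1 <= j < M.+1) (bern j.*2).[0] * t ^+ j.*2.
Proof.
elim: M => [|M IH].
  rewrite big_geq// !big_ord_recr big_ord0/= bern0_horner bern1_0; ring.
rewrite [in LHS]doubleS big_ord_recr big_ord_recr/= IH.
rewrite [X in _ + X * _](bern_odd0 R M) mul0r addr0.
by rewrite [in RHS]big_nat_recr//= doubleS addrA.
Qed.

(** Since t / (exp t - 1) = 1 - t/2 + t^2 phi(t), the remainder of [phi] is the previous one divided
    by t^2. *)
Lemma phi_sign M t : 0 < t ->
  0 < (-1) ^+ M *
      (phi t - \sum_(1 <= j < M.+1) (bern j.*2).[0] * t ^+ (j.-1).*2).
Proof.
move=> t0; have := bern_remainder_sign M t0; rewrite bern_sum_even.
have -> : \sum_(1 <= j < M.+1) (bern j.*2).[0] * t ^+ j.*2 =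
    t ^+ 2 * \sum_(1 <= j < M.+1) (bern j.*2).[0] * t ^+ (j.-1).*2.
  rewrite mulr_sumr; apply: eq_big_nat => -[//|j] _ /=.
  by rewrite doubleS -addn2 exprD; ring.
set S := \sum_(1 <= j < M.+1) _.
have e1 : expR t - 1 != 0 by rewrite gt_eqF// subr_gt0 -expR0 ltr_expR.
have -> : t / (expR t - 1) - (1 - t / 2 + t ^+ 2 * S) = t ^+ 2 * (phi t - S).
  rewrite /phi; by field; rewrite e1 gt_eqF.
by rewrite mulrCA pmulr_rgt0// exprn_gt0.
Qed.

Lemma phi_gt0 t : 0 < t -> 0 < phi t.
Proof. by move=> t0; have := phi_sign 0 t0; rewrite big_geq// subr0 expr0 mul1r. Qed.

(** Two consecutive remainders of [phi] at t = 1 have opposite signs, which fixes the sign of the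
    one term between them. *)
Lemma bern_even_sign M : 0 < (-1) ^+ M * (bern M.+1.*2).[0].
Proof.
have h0 := @phi_sign M 1 ltr01; have := @phi_sign M.+1 1 ltr01.
rewrite big_nat_recr//= expr1n mulr1 exprS mulN1r mulNr oppr_gt0 => h1.
have := ltr_leB h0 (ltW h1); rewrite subr0 -mulrBr.
by congr (0 < _ * _); ring.
Qed.

(** Adding the first omitted term (the odd one after it is zero) reverses the sign of the remainder,
    so the remainder is no larger than that term. *)
Lemma bern_remainder_le M t : 0 < t ->
  `|t / (expR t - 1) - \sum_(k < M.*2.+2) (bern k).[0] * t ^+ k| <=
  `|(bern M.+1.*2).[0]| * t ^+ M.*2.+2.
Proof.
move=> t0; have h0 := bern_remainder_sign M t0.
have := bern_remainder_sign M.+1 t0.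
rewrite doubleS big_ord_recr big_ord_recr/=.
rewrite [X in _ + X * _](bern_odd0 R M) mul0r addr0.
set G := t / _; set S := \sum_(k < _) _ in h0 * => h1.
have tm : 0 <= t ^+ M.*2.+2 by rewrite exprn_ge0// ltW.
rewrite -(ger0_norm tm) -normrM.
rewrite -[leLHS]mul1r -[leRHS]mul1r -(normr_sign R M) -!normrM ?signr_odd.
rewrite ger0_norm ?(ltW h0)// ler_normr; apply/orP; left.
move: h1; rewrite exprS mulN1r mulNr oppr_gt0 opprD addrA mulrDr mulrN subr_lt0.
exact: ltW.
Qed.

End bernoulli_remainder.

(** * Identification of the given Bernoulli numbers with the values of [bern] at 0 *)

Section bernoulli_numbers.
Variable R : realType.

(** Once the earlier coefficients are known to vanish, the bound for [m = k] divided by z^k gives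
    [|u k| <= E * z] for all small z > 0. *)
Lemma power_sum_coef_unique (u : nat -> R) :
  (forall m, exists C d : R, 0 < d /\ forall z : R, 0 < z < d ->
     `|\sum_(k < m.*2.+2) u k * z ^+ k| <= C * z ^+ m.*2.+2) ->
  forall k, u k = 0.
Proof.
move=> small; elim/ltn_ind => k IH.
have [C [d [d0 Hd]]] := small k.
have kk : (k.+1 <= k.*2.+2)%N by rewrite -addnn; lia.
pose E : R := \sum_(k.+1 <= i < k.*2.+2) `|u i| + `|C|.
have E0 : 0 <= E by rewrite addr_ge0// sumr_ge0.
have key (z : R) : 0 < z -> z < d -> z < 1 -> `|u k| <= E * z.
  move=> z0 zd z1; have := Hd z; rewrite z0 zd => /(_ isT).
  rewrite -(big_mkord xpredT (fun i => u i * z ^+ i)) (big_cat_nat (n := k.+1))//=.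
  rewrite big_nat_recr//= big1_seq ?add0r; last first.
    by move=> i; rewrite mem_index_iota => /andP[_ /andP[_ ik]]; rewrite IH// mul0r.
  set T := \sum_(_ <= _ < _) _ => le1.
  have zk : 0 < z ^+ k by rewrite exprn_gt0.
  have zle i : (k < i)%N -> z ^+ i <= z ^+ k * z.
    move=> ki; rewrite -exprSr; apply: ler_wiXn2l => //; exact: ltW.
  have leT : `|T| <= (\sum_(k.+1 <= i < k.*2.+2) `|u i|) * (z ^+ k * z).
    rewrite (le_trans (ler_norm_sum _ _ _))// mulr_suml; apply: ler_sum_nat => i /andP[ki _].
    by rewrite normrM ler_wpM2l// ger0_norm ?exprn_ge0 ?(ltW z0)// zle.
  have leC : C * z ^+ k.*2.+2 <= `|C| * (z ^+ k * z).
    rewrite (le_trans (ler_norm _))// normrM ler_wpM2l//.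
    by rewrite ger0_norm ?exprn_ge0 ?(ltW z0)// zle// -addnn; lia.
  have : `|u k * z ^+ k| <= E * (z ^+ k * z).
    rewrite -[u k * _](addrK T) /E mulrDl (le_trans (ler_normB _ _))// addrC.
    by rewrite lerD// (le_trans le1).
  by rewrite normrM (ger0_norm (ltW zk)) [z ^+ k * z]mulrC mulrA ler_pM2r.
apply/eqP; rewrite -normr_le0 leNgt; apply/negP => uk.
(* The last entry makes [E * w] at most half of [|u k|]; the other two keep [w] where [key]
   applies. *)
pose w := Num.min (Num.min (d / 2) 2^-1) (`|u k| / (E + 1) / 2).
have E1 : 0 < E + 1 by rewrite ltr_wpDl.
have d2 : 0 < d / 2 by rewrite divr_gt0.
have u2 : 0 < `|u k| / (E + 1) / 2 by do 2 rewrite divr_gt0//.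
have w0 : 0 < w by rewrite /w !lt_min d2 u2 invr_gt0 ltr0n.
have wd : w < d by rewrite /w !gt_min ltr_pdivrMr// ltr_pMr// ltr1n.
have w1 : w < 1 by rewrite /w !gt_min (_ : 2^-1 < 1 :> R) ?orbT// invf_lt1// ltr1n.
have := key w w0 wd w1.
have : w <= `|u k| / (E + 1) / 2 by rewrite /w ge_min lexx orbT.
rewrite -mulrA -invfM ler_pdivlMr ?mulr_gt0// => h1 h2.
have : E * w <= w * (E + 1) by rewrite mulrC ler_wpM2l ?(ltW w0)// lerDl.
nra.
Qed.

Lemma geometric_half_le (q : R) n : 0 <= q <= 2^-1 -> \sum_(i < n) q ^+ i <= 2.
Proof.
move=> /andP[q0 q2]; elim: n => [|n IH]; first by rewrite big_ord0.
rewrite big_ord_recl expr0 (_ : 2 = 1 + 1 :> R)//.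
under eq_bigr do rewrite exprS.
rewrite -mulr_sumr lerD2l.
apply: (@le_trans _ _ (2^-1 * 2)); last by rewrite mulVf.
by apply: ler_pM => //; apply: sumr_ge0 => i _; exact: exprn_ge0.
Qed.

(** Bounded terms at [z0] become geometric at [z], with ratio at most 1/2; the geometric sum
    accounts for the factor 2. *)
Lemma power_series_tail_le (c : nat -> R) (C z0 z G : R) m : 0 < z0 ->
  0 < z <= z0 / 2 -> (forall k, `|c k * z0 ^+ k| <= C) ->
  series (fun k => c k * z ^+ k) @ \oo --> G ->
  `|G - \sum_(k < m) c k * z ^+ k| <= 2 * C / z0 ^+ m * z ^+ m.
Proof.
move=> z00 /andP[z_gt0 zz0] Cb cvG.
have C0 : 0 <= C by rewrite (le_trans _ (Cb 0%N)).
set q := z / z0.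
have q0 : 0 <= q by rewrite divr_ge0// ltW.
have q2 : q <= 2^-1 by rewrite ler_pdivrMr// mulrC.
rewrite -mulrA [_^-1 * _]mulrC -expr_div_n -/q.
set S := \sum_(k < m) _.
have h : `|series (fun k => c k * z ^+ k) n - S| @[n --> \oo] --> `|G - S|.
  by apply: cvg_norm; apply: cvgB => //; exact: cvg_cst.
rewrite -(cvg_lim (@norm_hausdorff _ _) h)//.
apply: limr_le; first by apply/cvg_ex; exists `|G - S|.
near=> n.
have mn : (m <= n)%N by near: n; exact: nbhs_infty_ge.
rewrite /series/= /S -(big_mkord xpredT (fun k => c k * z ^+ k)).
rewrite (big_cat_nat (n := m))//= addrAC subrr add0r.
rewrite (le_trans (ler_norm_sum _ _ _))//.
apply: (@le_trans _ _ (\sum_(m <= k < n) C * q ^+ k)).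
  apply: ler_sum => k _; have -> : z ^+ k = z0 ^+ k * q ^+ k.
    by rewrite -exprMn /q mulrC divfK ?gt_eqF.
  by rewrite mulrA normrM (ger0_norm (exprn_ge0 _ q0)) ler_wpM2r ?exprn_ge0.
rewrite -{1}[m]add0n big_addn big_mkord.
under eq_bigr do rewrite exprD mulrCA mulrA.
rewrite -!mulr_suml !ler_wpM2r ?exprn_ge0//; apply: geometric_half_le; rewrite q0.
exact: q2.
Unshelve. all: by end_near.
Qed.

(** Truncations of both families lie within O(z^(2m+2)) of z / (exp z - 1): the given one by the
    tail of a convergent series, [bern] by [bern_remainder_le]. Their coefficients therefore
    agree. *)
Lemma is_bernoulli_bern (B : nat -> R -> R) : is_bernoulli B ->
  forall k, B k 0 = k`!%:R * (bern k).[0].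
Proof.
move=> /(_ 0)/nbhs_ballP[d /= d0 Bd] k.
pose c k := B k 0 / k`!%:R.
have cG z : 0 < z < d ->
    series (fun k => c k * z ^+ k) @ \oo --> z / (expR z - 1).
  move=> /andP[z0 zd]; have := Bd z; rewrite mul0r expR0 mulr1; apply.
    by rewrite /ball/= sub0r normrN gtr0_norm.
  by rewrite gt_eqF.
pose z0 := d / 2.
have z00 : 0 < z0 by rewrite divr_gt0.
have z0d : z0 < d by rewrite /z0 ltr_pdivrMr// ltr_pMr// ltr1n.
have [C Cb] : exists C, forall k, `|c k * z0 ^+ k| <= C.
  have cv : cvgn (series (fun k => c k * z0 ^+ k)).
    by apply/cvg_ex; eexists; apply: cG; rewrite z00.
  have := cvg_series_cvg_0 cv => /cvgP/cvg_seq_bounded[M [_ HM]].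
  by exists (M + 1) => i; apply: HM => //; rewrite ltrDl.
suff : forall k, c k - (bern k).[0] = 0.
  move=> /(_ k)/eqP; rewrite subr_eq0 => /eqP <-.
  by rewrite mulrC divfK// pnatr_eq0 -lt0n fact_gt0.
apply: power_sum_coef_unique => m.
exists (2 * C / z0 ^+ m.*2.+2 + `|(bern m.+1.*2).[0]|), (z0 / 2).
split; first by rewrite divr_gt0.
move=> z /andP[z_gt0 zz]; rewrite mulrDl.
have zd : z < d by rewrite (lt_trans zz)// (lt_trans _ z0d)// ltr_pdivrMr// ltr_pMr// ltr1n.
have h1 : `|z / (expR z - 1) - \sum_(k < m.*2.+2) c k * z ^+ k| <=
    2 * C / z0 ^+ m.*2.+2 * z ^+ m.*2.+2.
  by apply: power_series_tail_le => //; [rewrite z_gt0 ltW|apply: cG; rewrite z_gt0].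
have h2 := bern_remainder_le m z_gt0.
under eq_bigr do rewrite mulrBl.
rewrite sumrB -normrN; set G := z / _ in h1 h2.
set S1 := \sum_(k < _) _ in h1 *; set S2 := \sum_(k < _) _ in h2 *.
have -> : - (S1 - S2) = (G - S1) - (G - S2) by ring.
by rewrite (le_trans (ler_normB _ _))// lerD.
Qed.

End bernoulli_numbers.

(** * Integration over the half-line *)

Section half_line_integral.
Variable R : realType.
Implicit Types (f g : R -> R) (t v w l : R).

Local Notation mu := (@lebesgue_measure R).
Local Notation pos := (`]0, +oo[%classic : set R).

(** Integrability is bundled with a real value, so that linear combinations carry no finiteness side
    conditions. *)
Definition has_integral f v :=
  mu.-integrable pos (EFin \o f) /\ (\int[mu]_(t in pos) (f t)%:E = v%:E)%E.

Let mpos : measurable (pos : set (measurableTypeR R)). Proof. exact: measurable_itv. Qed.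

Let in_pos (t : R) : (pos t) = (0 < t) :> Prop.
Proof. by rewrite /= in_itv/= andbT. Qed.

Lemma has_integral_ext f g v : (forall t, 0 < t -> f t = g t) ->
  has_integral f v -> has_integral g v.
Proof.
move=> fg [fi fv]; have fgE : {in pos, EFin \o f =1 EFin \o g}.
  by move=> t; rewrite inE in_pos => t0; rewrite /= fg.
split; first by apply: eq_integrable fi.
by rewrite -fv; apply: eq_integral => t tp; exact/esym/fgE.
Qed.

Lemma has_integralD f g v w : has_integral f v -> has_integral g w ->
  has_integral (fun t => f t + g t) (v + w).
Proof.
move=> [fi fv] [gi gw]; split; first exact: (integrableD mpos fi gi).
by rewrite EFinD -fv -gw -integralD.
Qed.

Lemma has_integralZ c f v : has_integral f v ->
  has_integral (fun t => c * f t) (c * v).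
Proof.
move=> [fi fv]; split; first exact: (integrableZl mpos c fi).
by rewrite EFinM -fv -integralZl.
Qed.

Lemma has_integralN f v : has_integral f v -> has_integral (fun t => - f t) (- v).
Proof.
by move=> /(has_integralZ (-1)); rewrite mulN1r; apply: has_integral_ext => t _;
  rewrite mulN1r.
Qed.

Lemma has_integralB f g v w : has_integral f v -> has_integral g w ->
  has_integral (fun t => f t - g t) (v - w).
Proof. by move=> fv /has_integralN; exact: has_integralD. Qed.

Lemma has_integral0 : has_integral (fun=> 0) 0.
Proof. by split; [exact: integrable0|rewrite integral0_eq]. Qed.

Lemma has_integral_sum (F : nat -> R -> R) (v : nat -> R) m n :
  (forall k, has_integral (F k) (v k)) ->
  has_integral (fun t => \sum_(m <= k < n) F k t) (\sum_(m <= k < n) v k).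
Proof.
move=> Fv; rewrite /index_iota; elim: (iota _ _) => [|k s IH].
  rewrite big_nil; apply: has_integral_ext has_integral0 => t _.
  by rewrite big_nil.
rewrite big_cons; apply: has_integral_ext (has_integralD (Fv k) IH) => t _.
by rewrite big_cons.
Qed.

Lemma has_integral_measurable f v : has_integral f v -> measurable_fun pos f.
Proof. by move=> [/integrableP[/measurable_EFinP]]. Qed.

Lemma has_integral_ge0 f v : (forall t, 0 < t -> 0 <= f t) ->
  measurable_fun pos f -> (\int[mu]_(t in pos) (f t)%:E = v%:E)%E ->
  has_integral f v.
Proof.
move=> f0 mf fv; split => //; apply/integrableP; split.
  exact/measurable_EFinP.
rewrite (_ : (\int[mu]_(_ in _) _)%E = v%:E) ?ltry// -fv.
apply: eq_integral => t; rewrite inE in_pos => t0 /=.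
by rewrite ger0_norm// f0.
Qed.

Lemma has_integral_dominated f g w : (forall t, 0 < t -> 0 <= f t <= g t) ->
  measurable_fun pos f -> has_integral g w ->
  exists2 v, has_integral f v & 0 <= v <= w.
Proof.
move=> fg mf gw; have mg := has_integral_measurable gw.
have := gw => -[_ gwE].
have f0 t : pos t -> (0 <= (f t)%:E)%E.
  by rewrite in_pos lee_fin => /fg/andP[].
have le_fg : (\int[mu]_(t in pos) (f t)%:E <= w%:E)%E.
  rewrite -gwE; apply: ge0_le_integral => //; try exact/measurable_EFinP.
  by move=> t; rewrite in_pos lee_fin => /fg/andP[].
have ge0 := integral_ge0 mu f0.
have fin : (\int[mu]_(t in pos) (f t)%:E)%E \is a fin_num.
  by rewrite ge0_fin_numE// (le_lt_trans le_fg)// ltry.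
exists (fine (\int[mu]_(t in pos) (f t)%:E)%E).
  apply: has_integral_ge0 => //; last by rewrite fineK.
  by move=> t; rewrite -in_pos => /f0; rewrite lee_fin.
by rewrite -!lee_fin fineK// ge0 le_fg.
Qed.

(** A zero integral would confine the points of (0, 1), where [f] is positive, to a null set. This
    is the source of strictness in the final bracketing. *)
Lemma has_integral_gt0 f v : (forall t, 0 < t -> 0 < f t) ->
  has_integral f v -> 0 < v.
Proof.
move=> f0 fv; have [_ fvE] := fv; have mf := has_integral_measurable fv.
have v0 : 0 <= v.
  by rewrite -lee_fin -fvE integral_ge0// => t; rewrite in_pos lee_fin => /f0/ltW.
rewrite lt_neqAle v0 andbT eq_sym; apply/eqP => v_eq0.
have mEf : measurable_fun (pos : set (measurableTypeR R)) (EFin \o f).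
  exact/measurable_EFinP.
have [+ _] := ae_eq_integral_abs mu mpos mEf; case.
  transitivity v%:E; last by rewrite v_eq0.
  rewrite -fvE; apply: eq_integral => t; rewrite inE in_pos => t0 /=.
  by rewrite gtr0_norm// f0.
move=> N [mN N0 sub].
have : (mu `]0%R, 1%R[%classic <= mu N)%E.
  apply: le_measure; rewrite ?inE//.
  move=> t; rewrite /= in_itv/= => /andP[t0 _]; apply: sub => /=.
  by rewrite in_itv/= t0 => /(_ isT)[] /eqP; rewrite gt_eqF// f0.
by rewrite N0 lebesgue_measure_itv/= lte_fin ltr01 -EFinB lee_fin subr0 ler10.
Qed.

Lemma has_integral_FTC f F l : (forall t, 0 <= t -> 0 <= f t) -> continuous f ->
  (forall t, is_derive t 1 F (f t)) -> F t @[t --> +oo] --> l ->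
  has_integral f (l - F 0).
Proof.
move=> f0 cf dF Fl; have mf : measurable_fun setT f by exact: continuous_measurable_fun.
apply: has_integral_ge0.
- by move=> t /ltW; exact: f0.
- exact: measurable_funTS.
rewrite integral_itv_obnd_cbnd; last by apply/measurable_EFinP; exact: measurable_funTS.
rewrite (@ge0_continuous_FTC2y R f F 0 l)//.
- by apply: continuous_subspaceT.
- apply: cvg_at_right_filter; apply: differentiable_continuous.
  by apply/derivable1_diffP; have [] := dF 0.
- by move=> t _; rewrite derive1E; have [_ ->] := dF t.
Qed.

Lemma expR_monomial_cvg0 k l : 0 < l ->
  expR (- (l * t)) * (l * t) ^+ k / k`!%:R @[t --> +oo] --> (0 : R).
Proof.
move=> l0.
apply: (@squeeze_cvgr _ _ _ _ (fun=> 0) (fun t : R => k.+1%:R / l * t^-1)).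
- near=> t; have t0 : 0 < t by near: t; exact: nbhs_pinfty_gt.
  have lt0 : 0 < l * t by rewrite mulr_gt0.
  apply/andP; split; first by rewrite !mulr_ge0 ?expR_ge0 ?invr_ge0// exprn_ge0// ltW.
  rewrite expRN -mulrA -mulrA mulrC ler_pdivrMr ?expR_gt0//.
  rewrite -mulrA -invfM.
  have := expR_ge1Dxn k (ltW lt0).
  rewrite -(ler_pM2l (_ : 0 < k.+1%:R / (l * t))) ?divr_gt0//.
  move=> h; rewrite [leRHS]mulrA; apply: le_trans h; rewrite mulrDr mulr1.
  apply: (@le_trans _ _ (k.+1%:R / (l * t) * ((l * t) ^+ k.+1 / k.+1`!%:R))).
    rewrite factS natrM exprS; set u := l * t in lt0 *.
    rewrite le_eqVlt; apply/orP; left; apply/eqP; field.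
    by rewrite (gt_eqF lt0) nat1r !pnatr_eq0 -lt0n fact_gt0.
  by rewrite lerDr divr_ge0// ltW.
- exact: cvg_cst.
- rewrite -(mulr0 (k.+1%:R / l)); apply: cvgM; first exact: cvg_cst.
  apply/gtr0_cvgV0; last exact: cvg_id.
  by near=> t; near: t; exact: nbhs_pinfty_gt.
Unshelve. all: by end_near.
Qed.

Lemma is_derive_exprn k t : is_derive t 1 (fun u : R => u ^+ k.+1) (k.+1%:R * t ^+ k).
Proof.
have := is_derive_poly ('X ^+ k.+1 : {poly R}) t.
rewrite derivXn hornerMn hornerXn mulr_natl; congr is_derive.
by apply/funext => u; rewrite hornerXn.
Qed.

(** The normalized upper incomplete gamma function Gamma(k+1, l t) / k!: it is 1 at 0, tends to 0 at
    infinity, and its derivative telescopes to one term. *)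
Definition exp_poly k l t : R :=
  \sum_(i < k.+1) expR (- (l * t)) * (l * t) ^+ i / i`!%:R.

Lemma is_derive_exp_poly k l t : is_derive t 1 (exp_poly k l)
  (- (l * (expR (- (l * t)) * (l * t) ^+ k / k`!%:R))).
Proof.
elim: k => [|k IH].
  rewrite (_ : exp_poly 0 l = fun t => expR (- (l * t))); last first.
    by apply/funext => u; rewrite /exp_poly big_ord1 expr0 fact0 divr1 mulr1.
  by apply: trigger_derive; rewrite /GRing.scale/= fact0 expr0; field.
have -> : exp_poly k.+1 l = fun t => exp_poly k l t +
    k.+1`!%:R^-1 * (expR (- (l * t)) * (l * t) ^+ k.+1).
  by apply/funext => u; rewrite /exp_poly big_ord_recr/= [X in _ + X]mulrC.
have dl : is_derive t 1 (fun u : R => l * u) l.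
  by apply: trigger_derive; rewrite /GRing.scale/= mulr1.
have dX := is_derive1_comp (is_derive_exprn k (l * t)) dl.
have {}dX : is_derive t 1 (fun u : R => (l * u) ^+ k.+1) _ := dX.
apply: trigger_derive; rewrite /GRing.scale/= factS natrM exprS.
set e := expR _; set u := (_ * _) ^+ k.
by field; rewrite nat1r !pnatr_eq0 -lt0n fact_gt0.
Qed.

Lemma has_integral_monomial_exp k l : 0 < l ->
  has_integral (fun t => t ^+ k * expR (- (l * t))) (k`!%:R / l ^+ k.+1).
Proof.
move=> l0; pose c := - (k`!%:R / l ^+ k.+1).
have ck : k`!%:R != 0 :> R by rewrite pnatr_eq0 -lt0n fact_gt0.
have F0 : exp_poly k l 0 = 1.
  rewrite /exp_poly big_ord_recl big1 ?addr0; last first.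
    by move=> i _; rewrite mulr0 expr0n/= mulr0 mul0r.
  by rewrite mulr0 oppr0 expR0 expr0 fact0 divr1 mulr1.
have := @has_integral_FTC (fun t => t ^+ k * expR (- (l * t)))
  (fun t => c * exp_poly k l t) 0.
rewrite F0 mulr1 sub0r opprK; apply.
- by move=> t t0; rewrite mulr_ge0 ?expR_ge0// exprn_ge0.
- move=> t; apply: cvgM; first exact: exprn_continuous.
  apply: continuous_cvg; first exact: continuous_expR.
  by apply: cvgN; apply: cvgM; [exact: cvg_cst|exact: cvg_id].
- move=> t; have dE := is_derive_exp_poly k l t.
  apply: trigger_derive; rewrite /GRing.scale/= /c exprMn exprS.
  have l1 : l != 0 by rewrite gt_eqF.
  have lk : l ^+ k != 0 by rewrite expf_neq0.
  by field; rewrite ck l1 lk.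
- rewrite -(mulr0 c); apply: cvgM; first exact: cvg_cst.
  rewrite /exp_poly; elim: k.+1 => [|m IH].
    by under eq_fun do rewrite big_ord0; exact: cvg_cst.
  under eq_fun do rewrite big_ord_recr/=.
  by have := cvgD IH (expR_monomial_cvg0 m l0); rewrite addr0; exact.
Qed.

End half_line_integral.

(** * Binet's formula *)

Section theta.
Variable R : realType.
Implicit Types (l t x : R).

Local Notation mu := (@lebesgue_measure R).
Local Notation pos := (`]0, +oo[%classic : set R).

Lemma tonelli_rectangle (D1 D2 : set (measurableTypeR R)) (g : R -> R -> R) :
  measurable D1 -> measurable D2 ->
  measurable_fun [set: measurableTypeR R * measurableTypeR R] (fun z => g z.1 z.2) ->
  (forall t x, D1 t -> D2 x -> 0 <= g t x) ->
  (\int[mu]_(t in D1) \int[mu]_(x in D2) (g t x)%:E =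
   \int[mu]_(x in D2) \int[mu]_(t in D1) (g t x)%:E)%E.
Proof.
move=> mD1 mD2 mg g0.
(* The indicators extend [g] by zero outside the rectangle, so that Tonelli on the whole plane
   applies. *)
pose f (z : measurableTypeR R * measurableTypeR R) :=
  (g z.1 z.2 * (\1_D1 z.1 * \1_D2 z.2))%:E.
have mf : measurable_fun setT f.
  apply/measurable_EFinP; apply: measurable_funM => //; apply: measurable_funM.
    by apply: measurableT_comp; [exact: measurable_indic|exact: measurable_fst].
  by apply: measurableT_comp; [exact: measurable_indic|exact: measurable_snd].
have f0 z : (0 <= f z)%E.
  rewrite lee_fin !indicE; case: (boolP (z.1 \in D1)); last by rewrite mul0r mulr0.
  rewrite inE => z1; case: (boolP (z.2 \in D2)); last by rewrite !mulr0.
  by rewrite inE => z2; rewrite !mulr1 g0.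
have := @fubini_tonelli _ _ _ _ R mu mu f mf f0.
have step (D E : set (measurableTypeR R)) (h : R -> R -> R) :
    (\int[mu]_t \int[mu]_x (h t x * (\1_D t * \1_E x))%:E =
     \int[mu]_(t in D) \int[mu]_(x in E) (h t x)%:E)%E.
  rewrite [RHS]integral_mkcond; apply: eq_integral => t _; rewrite patchE.
  rewrite indicE; case: ifPn => tD.
    rewrite [RHS]integral_mkcond; apply: eq_integral => x _; rewrite patchE.
    by rewrite indicE; case: ifPn; rewrite mul1r ?mulr1 ?mulr0.
  by apply: integral0_eq => x _; rewrite mul0r mulr0.
rewrite /f/= step => ->; rewrite -[RHS](step D2 D1 (fun x t => g t x)).
apply: eq_integral => x _; apply: eq_integral => t _.
by rewrite [\1_D2 x * _]mulrC.
Qed.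

Lemma phi_measurable : measurable_fun pos (@phi R).
Proof.
apply: open_continuous_measurable_fun; first exact: interval_open.
move=> t; rewrite inE/= in_itv/= andbT => t0.
have tV : t^-1 @[t --> t] --> t^-1 by apply: cvgV; [rewrite gt_eqF|exact: cvg_id].
apply: cvgM => //; apply: cvgD; last exact: cvg_cst.
apply: cvgB => //; apply: cvgV.
  by rewrite gt_eqF// subr_gt0 -expR0 ltr_expR.
by apply: cvgB; [exact: continuous_expR|exact: cvg_cst].
Qed.

Lemma expR_measurable l : measurable_fun pos (fun t : R => expR (- (l * t))).
Proof.
apply: measurable_funTS; apply: continuous_measurable_fun => t.
apply: continuous_cvg; first exact: continuous_expR.
by apply: cvgN; apply: cvgM; [exact: cvg_cst|exact: cvg_id].
Qed.

(** Binet's function, the error term of Stirling's formula. For l > 0 the integral is finite by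
    [theta_spec], so [fine] loses nothing. *)
Definition theta l : R := fine (\int[mu]_(t in pos) (phi t * expR (- (l * t)))%:E).

(** The case M = 1 of [phi_sign] bounds [phi] by its value 1/12 at 0, that is [(bern 2).[0]]. The
    resulting decay in l later isolates the constant in Stirling's formula. *)
Lemma theta_spec l : 0 < l ->
  has_integral (fun t => phi t * expR (- (l * t))) (theta l) /\
  0 <= theta l <= (bern 2).[0] / l.
Proof.
move=> l0; set c := (bern 2).[0].
have [| |v vI vb] := has_integral_dominated (f := fun t => phi t * expR (- (l * t)))
    (g := fun t => c * (t ^+ 0 * expR (- (l * t)))) _ _
    (has_integralZ c (has_integral_monomial_exp 0 l0)).
- move=> t t0; rewrite mulr_ge0 ?expR_ge0 ?(ltW (phi_gt0 t0))//= expr0 mul1r.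
  rewrite ler_wpM2r ?expR_ge0//; have := phi_sign 1 t0.
  by rewrite big_nat1 expr0 mulr1 expr1 mulN1r oppr_gt0 subr_lt0 => /ltW.
- by apply: measurable_funM; [exact: phi_measurable|exact: expR_measurable].
have vE : theta l = v by rewrite /theta; have [_ ->] := vI.
by rewrite vE; split => //; move: vb; rewrite expr1 fact0 mul1r.
Qed.

(** The weight x (1 - x) / 2 is the Peano kernel of the trapezoidal rule. Being nonnegative, it
    makes Tonelli applicable to the double integral. *)
Lemma phi_increment l t : 0 < t ->
  (\int[mu]_(x in `[0%R, 1%R]) (x * (1 - x) / 2 * (t * expR (- ((l + x) * t))))%:E =
   (phi t * expR (- (l * t)) - phi t * expR (- ((l + 1) * t)))%:E)%E.
Proof.
move=> t0; have tn : t != 0 by rewrite gt_eqF.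
(* Two integrations by parts: with w = x (1 - x) / 2, the second factor is - w - w'/t - w''/t^2. *)
pose F x := expR (- ((l + x) * t)) *
  (- (x * (1 - x) / 2) - (1 - 2 * x) / (2 * t) + (t * t)^-1).
have dF x : is_derive x 1 F (x * (1 - x) / 2 * (t * expR (- ((l + x) * t)))).
  by apply: trigger_derive; rewrite /GRing.scale/=; field.
have cF x : {for x, continuous F}.
  by apply: differentiable_continuous; apply/derivable1_diffP; have [] := dF x.
rewrite (@continuous_FTC2 R _ F)//; last 3 first.
- apply: derivable_within_continuous => x _.
  by apply: derivableM => //; apply: derivableM.
- by split => [x _||]; [by have [] := dF x|apply: cvg_at_right_filter|
    apply: cvg_at_left_filter]; exact: cF.
- by move=> x _; rewrite derive1E; have [_ ->] := dF x.
rewrite -EFinB; congr EFin.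
rewrite /F /phi addr0 mulrDl mul1r opprD expRD.
have e1 : expR t - 1 != 0 by rewrite gt_eqF// subr_gt0 -expR0 ltr_expR.
have -> : expR (- t) = (expR t)^-1 by rewrite expRN.
by field; rewrite e1 tn gt_eqF// expR_gt0.
Qed.

(** Both sides are the error of the trapezoidal rule for [ln] on [l, l + 1], whose second derivative
    is -1 / y^2. *)
Lemma rational_integral l : 0 < l ->
  (\int[mu]_(x in `[0%R, 1%R]) (x * (1 - x) / 2 * ((l + x) ^+ 2)^-1)%:E =
   ((l + 2^-1) * (ln (l + 1) - ln l) - 1)%:E)%E.
Proof.
move=> l0.
pose F x := - (x / 2) + (l + 2^-1) * ln (l + x) + l * (l + 1) / 2 * (l + x)^-1.
have dF x : 0 <= x -> is_derive x 1 F (x * (1 - x) / 2 * ((l + x) ^+ 2)^-1).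
  move=> x0; have lx : 0 < l + x by rewrite ltr_wpDr.
  have lxn : l + x != 0 by rewrite gt_eqF.
  have d1 : is_derive x 1 (fun y : R => l + y) 1.
    have := is_deriveD (is_derive_cst l x 1) (is_derive_id x (1 : R)).
    by rewrite add0r; exact.
  have d2 : is_derive x 1 (fun y : R => ln (l + y)) ((l + x)^-1 * 1).
    exact: (@is_derive1_comp R (@ln R) (fun y => l + y) x _ _ (is_derive1_ln lx) d1).
  have d3 : is_derive x 1 (fun y : R => (l + y)^-1) (- (l + x) ^- 2 *: 1).
    exact: (is_deriveV lxn d1).
  by apply: trigger_derive; rewrite /GRing.scale/= ; field.
have cF x : 0 <= x -> {for x, continuous F}.
  by move=> x0; apply: differentiable_continuous; apply/derivable1_diffP; have [] := dF x x0.
rewrite (@continuous_FTC2 R _ F)//; last 3 first.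
- apply: derivable_within_continuous => x; rewrite in_itv/= => /andP[x0 _].
  have lxn : (l + x) ^+ 2 != 0 by rewrite expf_neq0// gt_eqF// ltr_wpDr.
  by apply: derivableM => //; apply: derivableV => //.
- split => [x||]; first by rewrite in_itv/= => /andP[/ltW x0 _]; have [] := dF x x0.
    by apply: cvg_at_right_filter; exact: cF.
  by apply: cvg_at_left_filter; exact: cF.
- by move=> x; rewrite in_itv/= => /andP[/ltW x0 _]; rewrite derive1E; have [_ ->] := dF x x0.
rewrite -EFinB; congr EFin; rewrite /F addr0.
by field; rewrite !gt_eqF// ltr_wpDr.
Qed.

Lemma has_integral_linear_exp l : 0 < l ->
  has_integral (fun t => t * expR (- (l * t))) (l ^+ 2)^-1.
Proof.
move=> /(has_integral_monomial_exp 1); rewrite (_ : 1`! = 1%N)// div1r.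
by apply: has_integral_ext => t _; rewrite expr1.
Qed.

Lemma kernel_measurable l :
  measurable_fun [set: measurableTypeR R * measurableTypeR R]
    (fun z => z.2 * (1 - z.2) / 2 * (z.1 * expR (- ((l + z.2) * z.1)))).
Proof.
pose p1 (z : measurableTypeR R * measurableTypeR R) : R := z.1.
pose p2 (z : measurableTypeR R * measurableTypeR R) : R := z.2.
have m1 : measurable_fun setT p1 by exact: measurable_fst.
have m2 : measurable_fun setT p2 by exact: measurable_snd.
have mc (c : R) : measurable_fun setT (fun _ : measurableTypeR R * measurableTypeR R => c).
  exact: measurable_cst.
have q := measurable_funM (measurable_funM m2 (measurable_funB (mc 1) m2)) (mc 2^-1).
have e := measurableT_comp (@measurable_expR R)
  (measurable_funN (measurable_funM (measurable_funD (mc l) m2) m1)).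
exact: (measurable_funM q (measurable_funM m1 e)).
Qed.

(** After the exchange, the inner integral of t exp(-(l + x) t) over t is 1 / (l + x)^2, which
    leaves [rational_integral]. *)
Lemma theta_increment l : 0 < l ->
  theta l - theta (l + 1) = (l + 2^-1) * (ln (l + 1) - ln l) - 1.
Proof.
move=> l0; have l10 : 0 < l + 1 by rewrite ltr_wpDr.
have [[_ vE] _] : has_integral (fun t => phi t * expR (- (l * t)) -
    phi t * expR (- ((l + 1) * t))) (theta l - theta (l + 1)) /\ True.
  split=> //; apply: has_integralB; first exact: (theta_spec l0).1.
  exact: (theta_spec l10).1.
apply: EFin_inj; rewrite -vE -rational_integral//.
have := @tonelli_rectangle pos `[0, 1]%classic
  (fun t x => x * (1 - x) / 2 * (t * expR (- ((l + x) * t)))).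
move=> /(_ (measurable_itv _) (measurable_itv _)) h.
transitivity (\int[mu]_(t in pos) \int[mu]_(x in `[0%R, 1%R])
    (x * (1 - x) / 2 * (t * expR (- ((l + x) * t))))%:E)%E.
  apply: eq_integral => t; rewrite inE/= in_itv/= andbT => t0.
  by rewrite phi_increment.
rewrite h.
- apply: eq_integral => x; rewrite inE/= in_itv/= => /andP[x0 x1].
  have lx : 0 < l + x by rewrite ltr_wpDr.
  have [_ <- //] := has_integralZ (x * (1 - x) / 2) (has_integral_linear_exp lx).
- exact: kernel_measurable.
- move=> t x; rewrite /= !in_itv/= andbT => t0 /andP[x0 x1].
  by rewrite !mulr_ge0 ?expR_ge0 ?subr_ge0 ?(ltW t0).
Qed.

End theta.

(** * Wallis integrals and Stirling's formula with its exact error term *)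

Section stirling.
Variable R : realType.

Local Notation mu := (@lebesgue_measure R).

Definition wallis n : R := \int[mu]_(x in `[0, pi / 2]) (sin x ^+ n).

Let pi2_gt0 : 0 < pi / 2 :> R. Proof. by rewrite divr_gt0// pi_gt0. Qed.

Let sin_exp_continuous n : continuous (fun x : R => sin x ^+ n).
Proof.
move=> x; apply: (@continuous_comp _ _ _ sin (fun y : R => y ^+ n)).
  exact: continuous_sin.
exact: exprn_continuous.
Qed.

Let sin_exp_integrable n :
  mu.-integrable `[0, pi / 2] (EFin \o (fun x : R => sin x ^+ n)).
Proof.
apply: continuous_compact_integrable; first exact: segment_compact.
exact: continuous_subspaceT.
Qed.

Lemma Rintegral_FTC (f F : R -> R) (a b : R) : a < b -> continuous f ->
  (forall x : R, is_derive x 1 F (f x)) ->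
  \int[mu]_(x in `[a, b]) f x = F b - F a.
Proof.
move=> ab cf dF; have cF x : {for x, continuous F}.
  by apply: differentiable_continuous; apply/derivable1_diffP; have [] := dF x.
rewrite /Rintegral (@continuous_FTC2 R f F a b)//.
- exact: continuous_subspaceT.
- split => [x _||]; [by have [] := dF x|apply: cvg_at_right_filter|
    apply: cvg_at_left_filter]; exact: cF.
- by move=> x _; rewrite derive1E; have [_ ->] := dF x.
Qed.

Lemma wallis0 : wallis 0 = pi / 2.
Proof.
rewrite /wallis (@Rintegral_FTC _ id)//; first by rewrite subr0.
Qed.

Lemma wallis1 : wallis 1 = 1.
Proof.
have dcos (x : R) : is_derive x 1 (fun x : R => - cos x) (sin x ^+ 1).
  by apply: trigger_derive; rewrite opprK expr1.
rewrite /wallis (Rintegral_FTC pi2_gt0 (@sin_exp_continuous 1%N) dcos).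
by rewrite cos_pihalf cos0 oppr0 sub0r opprK.
Qed.

Lemma wallis_rec n : n.+2%:R * wallis n.+2 = n.+1%:R * wallis n.
Proof.
have cont : continuous (fun x : R => n.+1%:R * sin x ^+ n - n.+2%:R * sin x ^+ n.+2).
  move=> x; apply: cvgB; apply: cvgM; try exact: cvg_cst.
    exact: sin_exp_continuous.
  exact: sin_exp_continuous.
have dsc (x : R) : is_derive x 1 (fun x : R => sin x ^+ n.+1 * cos x)
    (n.+1%:R * sin x ^+ n - n.+2%:R * sin x ^+ n.+2).
  have dX := is_derive1_comp (is_derive_exprn n (sin x)) (is_derive_sin x).
  have {}dX : is_derive x 1 (fun u : R => sin u ^+ n.+1) _ := dX.
  apply: (trigger_derive (is_deriveM dX (is_derive_cos x))); rewrite /GRing.scale/=.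
  have c2 : cos x * cos x = 1 - sin x * sin x.
    by rewrite -!expr2 -(cos2Dsin2 x) addrK.
  have -> : cos x * (n.+1%:R * sin x ^+ n * cos x) =
    n.+1%:R * sin x ^+ n * (cos x * cos x) by ring.
  by rewrite c2 -[n.+2%:R]natr1 !exprS; ring.
have := Rintegral_FTC pi2_gt0 cont dsc.
rewrite cos_pihalf sin0 expr0n/= mulr0 mul0r subrr => h.
apply/esym/eqP; rewrite -subr_eq0 -[X in _ == X]h.
rewrite RintegralB//; last 2 first.
- exact: (integrableZl _ _ (sin_exp_integrable n)).
- exact: (integrableZl _ _ (sin_exp_integrable n.+2)).
by rewrite !RintegralZl.
Qed.

Lemma wallis_le n : wallis n.+1 <= wallis n.
Proof.
apply: le_Rintegral => // x; rewrite /= in_itv/= => /andP[x0 x2].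
rewrite ler_wiXn2l// ?sin_le1// sin_ge0_pi//; apply/andP; split => //.
by rewrite (le_trans x2)// ler_pdivrMr// ler_peMr ?pi_ge0// ler1n.
Qed.

Lemma wallis_mul n : n.+1%:R * (wallis n.+1 * wallis n) = pi / 2.
Proof.
elim: n => [|n IH]; first by rewrite wallis1 wallis0 !mul1r.
by rewrite mulrA wallis_rec mulrAC -mulrA.
Qed.

Lemma wallis_gt0 n : 0 < wallis n.
Proof.
have w0 k : 0 <= wallis k.
  apply: Rintegral_ge0 => x; rewrite /= in_itv/= => /andP[x0 x2].
  rewrite exprn_ge0// sin_ge0_pi//; apply/andP; split => //.
  by rewrite (le_trans x2)// ler_pdivrMr// ler_peMr ?pi_ge0// ler1n.
rewrite lt_neqAle w0 andbT eq_sym; apply/eqP => wn.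
by have := pi2_gt0; rewrite -(wallis_mul n) wn !mulr0 ltxx.
Qed.

Lemma wallis_even n : wallis n.*2 = 'C(n.*2, n)%:R / 4 ^+ n * (pi / 2).
Proof.
elim: n => [|n IH]; first by rewrite wallis0 bin0 expr0 divr1 mul1r.
have n2 : n.+1.*2%:R != 0 :> R by rewrite pnatr_eq0.
apply: (mulfI n2); rewrite doubleS in n2 *; rewrite wallis_rec IH.
have hC : (n.+1 * 'C(n.*2.+2, n.+1) = 2 * n.*2.+1 * 'C(n.*2, n))%N.
  have e1 := mul_bin_diag n.*2.+1 n; rewrite /= in e1.
  have e2 : 'C(n.*2.+1, n) = 'C(n.*2.+1, n.+1).
    by rewrite -bin_sub; [congr 'C(_, _)|]; lia.
  by rewrite binS e2; nia.
have : n.+1%:R * 'C(n.*2.+2, n.+1)%:R = 2 * n.*2.+1%:R * 'C(n.*2, n)%:R :> R.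
  by rewrite -!natrM hC.
have -> : n.*2.+2%:R = 2 * n.+1%:R :> R by rewrite -doubleS -mul2n natrM.
move=> hR; rewrite exprS.
have f4 : (4 : R) ^+ n != 0 by rewrite expf_neq0.
transitivity (2 * n.*2.+1%:R * 'C(n.*2, n)%:R * (pi / 4) / 4 ^+ n : R).
  by field.
by rewrite -hR; field.
Qed.

(** What remains of ln m! after the growing terms of Stirling's formula; it decreases by the same
    steps as [theta], so the two differ by a constant. *)
Definition binet m : R := ln m`!%:R - (m%:R + 2^-1) * ln m%:R + m%:R.

Lemma binet_increment m : (0 < m)%N ->
  binet m - binet m.+1 = (m%:R + 2^-1) * (ln (m%:R + 1) - ln m%:R) - 1.
Proof.
move=> m0; rewrite /binet factS natrM lnM ?posrE ?ltr0n ?fact_gt0//.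
by have -> : m.+1%:R = m%:R + 1 :> R; [rewrite natr1|ring].
Qed.

Lemma binet_theta m : (0 < m)%N ->
  binet m = theta m%:R + (binet 1 - theta (1 : R)).
Proof.
elim: m => // -[|m] IH _; first by rewrite addrC subrK.
have m0 : 0 < m.+1%:R :> R by rewrite ltr0n.
have := binet_increment (ltn0Sn m); rewrite -(theta_increment m0) IH//.
rewrite natr1; move: (theta m.+1%:R) (theta m.+2%:R) (binet m.+2).
by move: (binet 1) (theta 1) => u v x y z; lra.
Qed.

(** A constant c contributes 2c - c = c to the left side, while the contribution of [theta] decays;
    the right side involves only the ratio controlled by Wallis' product. *)
Lemma binet_double m : (0 < m)%N ->
  2 * binet m - binet m.*2 = (ln (2 * pi) -
    ln (('C(m.*2, m)%:R / 4 ^+ m) ^+ 2 * (pi * m%:R))) / 2.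
Proof.
move=> m0; rewrite /binet.
have fE : m.*2`!%:R = 'C(m.*2, m)%:R * (m`!%:R * m`!%:R) :> R.
  have := @bin_fact m.*2 m; rewrite -addnn leq_addr addnK => /(_ isT) <-.
  by rewrite !natrM.
have C0 : 0 < 'C(m.*2, m)%:R :> R by rewrite ltr0n bin_gt0 -addnn leq_addr.
have f0 : 0 < m`!%:R :> R by rewrite ltr0n fact_gt0.
have mR : 0 < m%:R :> R by rewrite ltr0n.
have p0 : 0 < pi :> R by exact: pi_gt0.
have f4 : 0 < (4 : R) ^+ m by rewrite exprn_gt0.
have -> : m.*2%:R = 2 * m%:R :> R by rewrite -mul2n natrM.
rewrite fE !lnM ?posrE ?mulr_gt0 ?exprn_gt0 ?divr_gt0 ?invr_gt0//.
rewrite lnV ?posrE// lnXn//.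
have -> : ln 4 = 2 * ln 2 :> R.
  by rewrite (_ : 4 = 2 * 2 :> R) ?lnM ?posrE// -?natrM//; ring.
by rewrite -(mulr_natl (2 * ln 2) m); field.
Qed.

(** The middle quantity is 2m W^2 / (pi/2) with W = [wallis m.*2]. Replacing one factor W by its
    larger or smaller neighbour gives a product evaluated by [wallis_mul]. *)
Lemma central_binomial_bounds m : (0 < m)%N ->
  2 * m%:R / (2 * m%:R + 1) <= ('C(m.*2, m)%:R / 4 ^+ m) ^+ 2 * (pi * m%:R : R) <= 1.
Proof.
move=> m0; set A := 'C(_, _)%:R / _; have p0 : 0 < pi :> R by exact: pi_gt0.
have WE : wallis m.*2 = A * (pi / 2) by exact: wallis_even.
have W0 := wallis_gt0 m.*2.
have mR : 0 < m%:R :> R by rewrite ltr0n.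
have m2 : m.*2%:R = 2 * m%:R :> R by rewrite -mul2n natrM.
have lo := wallis_mul m.*2; have hi := wallis_mul m.*2.-1.
rewrite prednK ?double_gt0// in hi.
have le1 := wallis_le m.*2; have le2 := wallis_le m.*2.-1.
rewrite prednK ?double_gt0// in le2.
rewrite -natr1 m2 in lo; rewrite m2 in hi.
have lo' : pi / 2 <= (2 * m%:R + 1) * (wallis m.*2 * wallis m.*2).
  by rewrite -lo ler_wpM2l ?addr_ge0 ?mulr_ge0 ?(ltW mR)// ler_wpM2r// ltW.
have hi' : 2 * m%:R * (wallis m.*2 * wallis m.*2) <= pi / 2.
  by rewrite -hi ler_wpM2l ?mulr_ge0 ?(ltW mR)// ler_wpM2l// ltW.
have AE : A ^+ 2 * (pi * m%:R) = 2 * m%:R * (wallis m.*2 * wallis m.*2) / (pi / 2).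
  have aux (q u w : R) : 0 < q ->
      w = u * (q / 2) -> u ^+ 2 * (q * m%:R) = 2 * m%:R * (w * w) / (q / 2).
    by move=> q0 ->; field; rewrite gt_eqF.
  exact: aux.
have p2 : 0 < pi / 2 :> R by rewrite divr_gt0.
rewrite AE [X in _ && X]ler_pdivrMr// mul1r hi' andbT ler_pdivlMr//.
have m1 : 0 < 2 * m%:R + 1 :> R by rewrite addr_gt0// mulr_gt0.
rewrite mulrAC ler_pdivrMr//.
have -> : 2 * m%:R * (wallis m.*2 * wallis m.*2) * (2 * m%:R + 1) =
  2 * m%:R * ((2 * m%:R + 1) * (wallis m.*2 * wallis m.*2)) by ring.
by rewrite ler_pM2l// mulr_gt0.
Qed.

(** Used with [k] = m, [t] and [u] the values of [theta] at m and 2m, [v] the unknown constant and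
    [x] the logarithm of the Wallis ratio; every error is O(1/m). *)
Lemma binet_error (v l x t u k w : R) : 0 < k ->
  2 * (t + v) - (u + v) = (l - x) / 2 -> 0 <= - x * k <= 1 / 2 ->
  0 <= t * k <= w -> 0 <= u * k <= w / 2 -> `|v - l / 2| * k <= 2 * w + 1.
Proof.
move=> k0 e /andP[x0 x1] /andP[t0 t1] /andP[u0 u1].
rewrite -(gtr0_norm k0) -normrM.
have -> : (v - l / 2) * k = (- x * k) / 2 - 2 * (t * k) + u * k.
  have -> : v = (l - x) / 2 - 2 * t + u by lra.
  by ring.
by rewrite ler_norml; apply/andP; split; lra.
Qed.

Lemma binet_constant : binet 1 - theta 1 = ln (2 * pi) / 2.
Proof.
set c := binet 1 - _; set C : R := (bern 2).[0].
have C0 : 0 <= C.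
  have [_ /andP[]] := theta_spec (@ltr01 R); rewrite divr1 => h0 h1.
  exact: le_trans h0 h1.
have key m : (0 < m)%N -> `|c - ln (2 * pi) / 2| * m%:R <= 2 * C + 1.
  move=> m0; have mR : 0 < m%:R :> R by rewrite ltr0n.
  have m2R : 0 < m.*2%:R :> R by rewrite ltr0n double_gt0.
  have m2 : m.*2%:R = 2 * m%:R :> R by rewrite -mul2n natrM.
  have := binet_double m0.
  rewrite (binet_theta m0) (@binet_theta m.*2) ?double_gt0// -/c.
  have [_ /andP[t0 t1]] := theta_spec mR.
  have [_ /andP[u0 u1]] := theta_spec m2R.
  have /andP[b0 b1] := central_binomial_bounds m0.
  set X := _ ^+ 2 * _ in b0 b1 *.
  have m1 : 0 < 2 * m%:R + 1 :> R by rewrite addr_gt0// mulr_gt0.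
  have X0 : 0 < X by rewrite (lt_le_trans _ b0)// divr_gt0// mulr_gt0.
  have lX0 : ln X <= 0 by rewrite ln_le0.
  have lX1 : - ln X <= (2 * m%:R)^-1.
    rewrite -lnV ?posrE//; have := @le_ln1Dx R (X^-1 - 1).
    rewrite (_ : 1 + (X^-1 - 1) = X^-1) => [h|]; last by ring.
    apply: (le_trans (h _)).
      by rewrite ltrBrDl subrr invr_gt0.
    rewrite lerBlDr (le_trans (_ : _ <= (2 * m%:R / (2 * m%:R + 1))^-1))//.
      by rewrite lef_pV2 ?posrE// divr_gt0// mulr_gt0.
    by rewrite le_eqVlt; apply/orP; left; apply/eqP; field; rewrite !gt_eqF.
  rewrite -/C in t1 u1; move=> e.
  have tm : theta m%:R * m%:R <= C by rewrite -ler_pdivlMr.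
  have um : theta m.*2%:R * m%:R <= C / 2.
    by rewrite ler_pdivlMr// -mulrA [m%:R * _]mulrC -m2 -ler_pdivlMr.
  have um0 := mulr_ge0 u0 (ltW mR).
  have tm0 := mulr_ge0 t0 (ltW mR).
  have l1 : - ln X * m%:R <= 1 / 2.
    by rewrite -ler_pdivlMr// (le_trans lX1)// invfM mul1r.
  have l0 : 0 <= - ln X * m%:R by rewrite mulr_ge0 ?oppr_ge0// ltW.
  by apply: (binet_error mR e); apply/andP.
apply/eqP; rewrite -subr_eq0 -normr_le0 leNgt; apply/negP => d0.
set d := `|_| in key d0.
have D0 : 0 <= (2 * C + 1) / d by rewrite divr_ge0 ?addr_ge0 ?mulr_ge0// ltW.
(* The defect times m is bounded by 2C + 1 for every m; this m exceeds the quotient of the bound by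
   the defect. *)
have := key (Num.truncn ((2 * C + 1) / d)).+1 (ltn0Sn _).
rewrite -ler_pdivlMl// mulrC leNgt => /negP; apply.
by rewrite truncnS_gt.
Qed.

Lemma stirling m : (0 < m)%N -> ln (m`!%:R : R) =
  (m%:R + 2^-1) * ln m%:R - m%:R + ln (2 * pi) / 2 + theta m%:R.
Proof. by move=> m0; have := binet_theta m0; rewrite binet_constant /binet; lra. Qed.

End stirling.

(** * The hypergeometric mean deviation *)

Section hypergeometric_moments.
Variable R : realType.

Lemma binz_nat m k : binz m k%:Z = 'C(m, k). Proof. by []. Qed.

Lemma binz_sub m n k : binz m (n%:Z - k%:Z) = if (k <= n)%N then 'C(m, n - k) else 0%N.
Proof.
case: leqP => kn; first by rewrite subzn// binz_nat.
by rewrite -opprB subzn ?(ltnW kn)// /binz; case: (k - n)%N (subn_gt0 n k) => [|j _]; rewrite ?kn.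
Qed.

Lemma hyp_pmf_nat N K n k : (k <= n)%N ->
  hyp_pmf R N K n k = 'C(K, k)%:R * 'C(N - K, n - k)%:R / 'C(N, n)%:R.
Proof. by move=> kn; rewrite /hyp_pmf binz_sub kn. Qed.

Lemma hyp_pmf_gt N K n k : (n < k)%N -> hyp_pmf R N K n k = 0.
Proof. by move=> kn; rewrite /hyp_pmf binz_sub leqNgt kn mulr0 mul0r. Qed.

Lemma hyp_pmf_sum N K n : (K <= N)%N -> (n <= N)%N ->
  \sum_(k < n.+1) hyp_pmf R N K n k = 1.
Proof.
move=> KN nN; under eq_bigr => k _ do rewrite (hyp_pmf_nat _ _ (ltn_ord k : k <= n)%N).
rewrite -mulr_suml; under eq_bigr => k _ do rewrite -natrM.
by rewrite -natr_sum binomial.Vandermonde subnKC// divff// pnatr_eq0 -lt0n bin_gt0.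
Qed.

Lemma mul_bin_leftR m k : k.+1%:R * 'C(m, k.+1)%:R = (m%:R - k%:R) * 'C(m, k)%:R :> R.
Proof.
have [km|mk] := leqP k m; first by rewrite -natrB// -!natrM mul_bin_left.
by rewrite !bin_small ?mulr0// ltnW.
Qed.

Lemma hyp_pmf_rec N K n k : (K <= N)%N -> (k <= n)%N ->
  (K%:R - k%:R) * (n%:R - k%:R) * hyp_pmf R N K n k =
  k.+1%:R * (N%:R - K%:R - n%:R + k.+1%:R) * hyp_pmf R N K n k.+1.
Proof.
move=> KN; rewrite leq_eqVlt => /predU1P[->|kn].
  by rewrite subrr mulr0 mul0r hyp_pmf_gt// mulr0.
rewrite !hyp_pmf_nat ?(ltnW kn)//.
have h1 := mul_bin_leftR K k.
have := mul_bin_leftR (N - K) (n - k.+1); rewrite -subSn// subSS.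
rewrite !natrB ?(ltnW kn)// => h2.
transitivity (((K%:R - k%:R) * 'C(K, k)%:R) *
  ((n%:R - k%:R) * 'C(N - K, n - k)%:R) / 'C(N, n)%:R : R); first by ring.
by rewrite h2 -h1; ring.
Qed.

(** A discrete antiderivative, vanishing at k = 0 and k = n + 1. At k = p the factor N - K - n + k
    is the fourth cell. *)
Definition deMoivre N K n k : R :=
  k%:R * (N%:R - K%:R - n%:R + k%:R) / N%:R * hyp_pmf R N K n k.

(** By [hyp_pmf_rec] both terms are multiples of P(k), and k (N - K - n + k) - (K - k)(n - k) = k N
    - n K. *)
Lemma deMoivre_increment N K n k : (0 < N)%N -> (K <= N)%N -> (k <= n)%N ->
  (k%:R - n%:R * K%:R / N%:R) * hyp_pmf R N K n k =
  deMoivre N K n k - deMoivre N K n k.+1.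
Proof.
move=> N0 KN kn; have Nn : N%:R != 0 :> R by rewrite pnatr_eq0 -lt0n.
have -> : deMoivre N K n k.+1 =
    (K%:R - k%:R) * (n%:R - k%:R) * hyp_pmf R N K n k / N%:R.
  by rewrite hyp_pmf_rec// /deMoivre mulrAC.
by rewrite /deMoivre; field.
Qed.

Lemma hyp_mean_deviation N K n p : (0 < N)%N -> (K <= N)%N -> (p <= n)%N ->
  p%:R = n%:R * K%:R / N%:R :> R ->
  \sum_(k < n.+1) `|k%:R - p%:R| * hyp_pmf R N K n k = 2 * deMoivre N K n p.
Proof.
move=> N0 KN pn pE; pose D := deMoivre N K n.
rewrite -(big_mkord xpredT (fun k => `|k%:R - p%:R| * hyp_pmf R N K n k)).
rewrite (big_cat_nat (n := p))//=; last exact: leq_trans pn _.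
(* The deviations below and above the mean each telescope to the same value [D p], hence the factor
   2. *)
have -> : \sum_(0 <= k < p) `|k%:R - p%:R| * hyp_pmf R N K n k = D p.
  transitivity (\sum_(0 <= k < p) (D k.+1 - D k)).
    apply: eq_big_nat => k /andP[_ kp].
    rewrite ler0_norm ?subr_le0 ?ler_nat 1?ltnW// mulNr pE deMoivre_increment//.
      by rewrite opprB.
    by rewrite (leq_trans (ltnW kp)).
  by rewrite telescope_sumr// /D /deMoivre !mul0r subr0.
have -> : \sum_(p <= k < n.+1) `|k%:R - p%:R| * hyp_pmf R N K n k = D p.
  transitivity (- \sum_(p <= k < n.+1) (D k.+1 - D k)).
    rewrite -sumrN; apply: eq_big_nat => k /andP[pk kn].
    by rewrite ger0_norm ?subr_ge0 ?ler_nat// pE deMoivre_increment// opprB.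
  rewrite telescope_sumr; last by rewrite leqW.
  by rewrite opprB /D {2}/deMoivre hyp_pmf_gt// mulr0 subr0.
by rewrite -mulr2n mulr_natl.
Qed.

(** The masses at 0, ..., n sum to 1 by Vandermonde, so [X] almost surely takes one of these values
    and the integrand almost surely equals the simple function [Y]. *)
Lemma hypergeometric_expectation (disp : measure_display)
    (T : measurableType disp) (P : probability T R) (X : {RV P >-> R})
    (N K n : nat) (m : R) : (K <= N)%N -> (n <= N)%N ->
  hypergeometric X N K n ->
  fine 'E_P[fun w => `|X w - m|] =
  \sum_(k < n.+1) `|k%:R - m| * hyp_pmf R N K n k.
Proof.
move=> KN nN hX.
have mX : measurable_fun setT X by [].
pose A (k : nat) := X @^-1` [set k%:R].
have mA k : measurable (A k).
  by rewrite -[A k]setTI; apply: mX.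
have PA k : P (A k) = (hyp_pmf R N K n k)%:E.
  have := hX k%:Z; rewrite /pmf -pmulrn => <-.
  by rewrite fineK// fin_num_measure.
pose U := \big[setU/set0]_(k < n.+1) A k.
have mU : measurable U by exact: bigsetU_measurable.
have tA : trivIset setT (fun k : 'I_n.+1 => A k).
  apply/trivIsetP => i j _ _ ij; apply/seteqP; split => // w [wi wj].
  have /eqP : i%:R = j%:R :> R by rewrite -[LHS]wi -[RHS]wj.
  by rewrite eqr_nat => /eqP/val_inj/eqP; rewrite (negbTE ij).
have PU : P U = 1%E.
  rewrite /U measure_bigsetU_ord//.
  rewrite (eq_bigr (fun k : 'I_n.+1 => (hyp_pmf R N K n k)%:E)) => [|k _].
    by rewrite sumEFin hyp_pmf_sum.
  exact: PA.
pose Y w : R := \sum_(k < n.+1) `|k%:R - m| * \1_(A k) w.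
have mXm : measurable_fun setT (fun w => `|X w - m|).
  by apply: measurableT_comp => //; apply: measurable_funB.
have mterm k : measurable_fun setT (fun w => `|k%:R - m| * \1_(A k) w).
  by apply: measurable_funM => //; exact: measurable_indic.
rewrite unlock (_ : (\int[P]_w _)%E = (\int[P]_w (Y w)%:E)%E); last first.
  apply: ge0_ae_eq_integral => //.
  - exact/measurable_EFinP.
  - by apply/measurable_EFinP; exact: measurable_sum.
  - by move=> w _; rewrite lee_fin; apply: sumr_ge0 => k _; rewrite mulr_ge0.
  exists (~` U); split; first exact: measurableC.
    by have := probability_setC P mU; rewrite PU subee//; exact.
  apply: subsetC => w; rewrite /U -bigcup_mkord => -[k /= kn Xw] _.
  congr EFin; rewrite /Y (bigD1 (Ordinal kn))//= big1 ?addr0.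
    by rewrite indicE mem_set// mulr1 Xw.
  move=> j jk; rewrite indicE memNset ?mulr0//.
  rewrite /A/= Xw => /eqP; rewrite eqr_nat => /eqP e.
  by move/eqP: jk; apply; apply: val_inj.
under eq_integral do rewrite -sumEFin.
rewrite ge0_integral_sum//; last by move=> k; exact/measurable_EFinP.
rewrite (eq_bigr (fun k : 'I_n.+1 => (`|k%:R - m| * hyp_pmf R N K n k)%:E)); last first.
  move=> k _; under eq_integral do rewrite EFinM.
  rewrite ge0_integralZl//.
  - by rewrite integral_indic// setIT EFinM; congr (_ * _)%E; exact: PA.
  - by apply/measurable_EFinP; exact: measurable_indic.
by rewrite sumEFin.
Qed.

End hypergeometric_moments.

(** * The two by two table with integer cells *)

Section four_cells.
Variable R : realType.

Lemma cell_decomposition (N K n p : nat) : (0 < p)%N -> (K < N)%N -> (n < N)%N ->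
  (N * p = n * K)%N -> exists q r s, [/\ [/\ (0 < q)%N, (0 < r)%N & (0 < s)%N],
    K = (p + q)%N, n = (p + r)%N, N = (p + q + r + s)%N & (p * s = q * r)%N].
Proof.
move=> p0 KN nN e.
have pK : (p < K)%N by nia.
have pn : (p < n)%N by nia.
(* N p = n K gives N (N + p - K - n) = (N - K)(N - n), which is positive. *)
have s0 : (K + n < N + p)%N by nia.
exists (K - p)%N, (n - p)%N, (N + p - (K + n))%N.
have [q Kq] : exists q, K = (p + q)%N by exists (K - p)%N; lia.
have [r nr] : exists r, n = (p + r)%N by exists (n - p)%N; lia.
have [s Ns] : exists s, N = (p + q + r + s)%N by exists (N - (p + q + r))%N; lia.
by subst K n N; split; [split|..]; nia.
Qed.

Lemma cell_products p q r s : (p * s = q * r)%N -> let N := (p + q + r + s)%N in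
  [/\ ((p + q) * (p + r) = N * p)%N, ((p + q) * (q + s) = N * q)%N,
    ((r + s) * (p + r) = N * r)%N & ((r + s) * (q + s) = N * s)%N].
Proof. by move=> e; split; rewrite !(mulnDl, mulnDr) ?e; lia. Qed.

Lemma ln_bin a b : ln ('C(a + b, a)%:R : R) =
  ln (a + b)`!%:R - ln a`!%:R - ln b`!%:R.
Proof.
have := bin_fact (leq_addr b a); rewrite addKn => <-.
rewrite !natrM !lnM ?posrE ?mulr_gt0 ?ltr0n ?fact_gt0 ?bin_gt0 ?leq_addr//.
by ring.
Qed.

Lemma ln_sqrt (x : R) : 0 < x -> ln (Num.sqrt x) = ln x / 2.
Proof.
move=> x0; rewrite -[in RHS](sqr_sqrtr (ltW x0)) lnXn ?sqrtr_gt0//.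
by rewrite mulr2n; lra.
Qed.

(** The signs are those with which the factorials of the margins, the cells and the total enter the
    logarithm of the mass at p. *)
Definition cell_sum (p q r s : nat) (v : R -> R) : R :=
  v (p + q)%:R + v (r + s)%:R + v (p + r)%:R + v (q + s)%:R -
  (v p%:R + v q%:R + v r%:R + v s%:R + v (p + q + r + s)%:R).

Variables p q r s : nat.
Hypotheses (p0 : (0 < p)%N) (q0 : (0 < q)%N) (r0 : (0 < r)%N) (s0 : (0 < s)%N).
Hypothesis psqr : (p * s = q * r)%N.

Local Notation N := (p + q + r + s)%N.
Local Notation K := (p + q)%N.
Local Notation n := (p + r)%N.

Let K0 : (0 < K)%N. Proof. by rewrite addn_gt0 p0. Qed.
Let n0 : (0 < n)%N. Proof. by rewrite addn_gt0 p0. Qed.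
Let rs0 : (0 < r + s)%N. Proof. by rewrite addn_gt0 r0. Qed.
Let qs0 : (0 < q + s)%N. Proof. by rewrite addn_gt0 q0. Qed.
Let cells0 : (0 < N)%N. Proof. by rewrite !addn_gt0 p0. Qed.
Let P0 : 0 < p%:R :> R. Proof. by rewrite ltr0n. Qed.
Let Q0 : 0 < q%:R :> R. Proof. by rewrite ltr0n. Qed.
Let R0 : 0 < r%:R :> R. Proof. by rewrite ltr0n. Qed.
Let S0 : 0 < s%:R :> R. Proof. by rewrite ltr0n. Qed.
Let N0 : 0 < N%:R :> R. Proof. by rewrite ltr0n. Qed.
Let Nn : N%:R != 0 :> R. Proof. by rewrite gt_eqF. Qed.

Let kappa : R := K%:R / N%:R.
Let eta : R := n%:R / N%:R.

Lemma cell_a : kappa * eta = p%:R / N%:R.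
Proof.
have h : K%:R * n%:R = p%:R * N%:R :> R.
  by have [e _ _ _] := cell_products psqr; rewrite -!natrM e mulnC.
by rewrite /kappa /eta mulf_div h invfM mulrA mulfK.
Qed.

Lemma cell_b : kappa * (1 - eta) = q%:R / N%:R.
Proof. by rewrite mulrBr mulr1 cell_a /kappa -mulrBl (natrD _ p q) addrAC subrr add0r. Qed.

Lemma cell_c : eta * (1 - kappa) = r%:R / N%:R.
Proof.
rewrite mulrBr mulr1 [eta * _]mulrC cell_a /eta -mulrBl (natrD _ p r) addrAC.
by rewrite subrr add0r.
Qed.

Lemma cell_d : (1 - kappa) * (1 - eta) = s%:R / N%:R.
Proof.
rewrite mulrBl mul1r cell_b /eta; apply: (mulIf Nn).
by rewrite !mulrBl !divfK// mul1r !natrD; ring.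
Qed.

Lemma DeltaE (t : R) : Delta N K n t = cell_sum p q r s (fun l => expR (- (l * t))).
Proof.
rewrite /Delta -/kappa -/eta cell_a cell_b cell_c cell_d /cell_sum.
have e1 : N%:R - K%:R = (r + s)%:R :> R by rewrite !natrD; ring.
have e2 : N%:R - n%:R = (q + s)%:R :> R by rewrite !natrD; ring.
have e3 (x : R) : N%:R * (x / N%:R) = x by rewrite mulrCA divff// mulr1.
by rewrite e1 e2 !e3.
Qed.

(** With x, y, z, w the exponentials of the four cells, u = x + w and v = y + z, the value is u v -
    u - v - x y z w. If u <= 1 or v <= 1 then u v <= u + v; otherwise both lie in (1, 2) and (u -
    1)(v - 1) < 1. *)
Lemma Delta_lt0 (t : R) : 0 < t -> Delta N K n t < 0.
Proof.
move=> t0; rewrite DeltaE /cell_sum !natrD !mulrDl !opprD !expRD.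
have bd (k : nat) : (0 < k)%N -> 0 < expR (- (k%:R * t)) < 1.
  by move=> k0; rewrite expR_gt0 expR_lt1 oppr_lt0 mulr_gt0 ?ltr0n.
move: (expR _) (bd _ p0) (expR _) (bd _ q0) (expR _) (bd _ r0) (expR _) (bd _ s0).
move=> x /andP[x0 x1] y /andP[y0 y1] z /andP[z0 z1] w /andP[w0 w1].
have pr : 0 < x * y * z * w by rewrite !mulr_gt0.
suff : (x + w) * (y + z) <= (x + w) + (y + z) by nra.
have [|u1] := lerP (x + w) 1; first by nra.
have [|v1] := lerP (y + z) 1; first by nra.
by nra.
Qed.

Lemma has_integral_cell_sum (f v : R -> R) :
  (forall l, 0 < l -> has_integral (fun t => f t * expR (- (l * t))) (v l)) ->
  has_integral (fun t => f t * Delta N K n t) (cell_sum p q r s v).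
Proof.
move=> h; have hn (k : nat) : (0 < k)%N ->
    has_integral (fun t => f t * expR (- (k%:R * t))) (v k%:R).
  by move=> k0; apply: h; rewrite ltr0n.
have pos1 := has_integralD (has_integralD (has_integralD
  (hn K K0) (hn (r + s)%N rs0)) (hn n n0)) (hn (q + s)%N qs0).
have pos2 := has_integralD (has_integralD (has_integralD (has_integralD
  (hn p p0) (hn q q0)) (hn r r0)) (hn s s0)) (hn N cells0).
apply: has_integral_ext (has_integralB pos1 pos2) => t _.
by rewrite DeltaE /cell_sum; ring.
Qed.

Lemma ln_mean_deviation :
  ln (2 * deMoivre R N K n p / Num.sqrt (2 * N%:R * (kappa * eta) *
    ((1 - kappa) * (1 - eta)) / pi)) = cell_sum p q r s (@theta R).
Proof.
have pi0 : 0 < pi :> R by exact: pi_gt0.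
have nK : (N - K = r + s)%N by rewrite -addnA addKn.
have np : (n - p = r)%N by rewrite addKn.
have nqs : (p + r + (q + s) = N)%N by rewrite addnACA addnA.
have pn : (p <= n)%N by exact: leq_addr.
have -> : 2 * N%:R * (kappa * eta) * ((1 - kappa) * (1 - eta)) / pi =
    2 * (p%:R * s%:R / N%:R) / pi.
  by rewrite cell_a cell_d; congr (_ / _); move: (N%:R : R) Nn => x xn; field.
have -> : deMoivre R N K n p = p%:R * s%:R / N%:R *
    ('C(p + q, p)%:R * 'C(r + s, r)%:R / 'C(p + r + (q + s), p + r)%:R).
  rewrite /deMoivre hyp_pmf_nat// nK np; congr (_ * _ / _ * (_ / _)).
    by rewrite !natrD; ring.
  by rewrite nqs.
have C1 : 0 < 'C(p + q, p)%:R :> R by rewrite ltr0n bin_gt0 leq_addr.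
have C2 : 0 < 'C(r + s, r)%:R :> R by rewrite ltr0n bin_gt0 leq_addr.
have C3 : 0 < 'C(p + r + (q + s), p + r)%:R :> R by rewrite ltr0n bin_gt0 leq_addr.
have lnMp (x y : R) : 0 < x -> 0 < y -> ln (x * y) = ln x + ln y.
  by move=> x0 y0; rewrite lnM ?posrE.
have lnVp (x y : R) : 0 < x -> 0 < y -> ln (x / y) = ln x - ln y.
  by move=> x0 y0; rewrite ln_div ?posrE.
have PSN : 0 < p%:R * s%:R / N%:R :> R by rewrite divr_gt0// mulr_gt0.
have CCC : 0 < 'C(p + q, p)%:R * 'C(r + s, r)%:R / 'C(p + r + (q + s), p + r)%:R :> R.
  by rewrite divr_gt0// mulr_gt0.
have PSN2 : 0 < 2 * (p%:R * s%:R / N%:R) :> R by rewrite mulr_gt0.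
have PSNC := mulr_gt0 PSN CCC.
rewrite lnVp ?sqrtr_gt0 ?(divr_gt0 PSN2)//; last by rewrite mulr_gt0.
rewrite ln_sqrt ?(divr_gt0 PSN2)// (lnVp _ _ PSN2)//.
rewrite !lnMp ?mulr_gt0 ?invr_gt0// !lnV ?posrE//.
rewrite !ln_bin nqs /cell_sum !stirling//.
have l2p : ln (2 * pi) = ln 2 + ln pi :> R by rewrite lnMp.
have lnmul (i j k l : nat) : (0 < i)%N -> (0 < j)%N -> (0 < k)%N -> (0 < l)%N ->
    (i * j = k * l)%N -> ln i%:R + ln j%:R = ln k%:R + ln l%:R :> R.
  by move=> i0 j0 k0 l0 e; rewrite -!lnM ?posrE ?ltr0n// -!natrM e.
have [ep eq er es] := cell_products psqr.
have hp := lnmul K n N p K0 n0 cells0 p0 ep.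
have hq := lnmul K (q + s)%N N q K0 qs0 cells0 q0 eq.
have hr := lnmul (r + s)%N n N r rs0 n0 cells0 r0 er.
have hs := lnmul (r + s)%N (q + s)%N N s rs0 qs0 cells0 s0 es.
rewrite l2p.
(* Each cell is the product of its two margins over N. Once the logarithms of the cells are
   eliminated, only a polynomial identity remains. *)
have -> : ln p%:R = ln K%:R + ln n%:R - ln N%:R :> R by lra.
have -> : ln q%:R = ln K%:R + ln (q + s)%:R - ln N%:R :> R by lra.
have -> : ln r%:R = ln (r + s)%:R + ln n%:R - ln N%:R :> R by lra.
have -> : ln s%:R = ln (r + s)%:R + ln (q + s)%:R - ln N%:R :> R by lra.
move: (ln K%:R) (ln n%:R) (ln N%:R) (ln (r + s)%:R) (ln (q + s)%:R) => a b c d e.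
move: (theta K%:R) (theta n%:R) (theta N%:R) (theta (r + s)%:R) (theta (q + s)%:R).
move: (theta p%:R) (theta q%:R) (theta r%:R) (theta s%:R) (ln 2) (ln pi) => *.
rewrite !natrD; move: (p%:R : R) (q%:R : R) (r%:R : R) (s%:R : R) => *.
by field.
Qed.

End four_cells.

(** * The coefficients at [h = 0] *)

Section coefficients.
Variable R : realType.
Variables (B : nat -> R -> R) (hB : is_bernoulli B).

Lemma bernoulli_odd0 i : B i.*2.+3 0 = 0.
Proof. by rewrite (is_bernoulli_bern hB) bern_odd0 mulr0. Qed.

Lemma bernoulli_even_sign i : 0 < (-1) ^+ i * B i.*2.+2 0.
Proof.
rewrite (is_bernoulli_bern hB) mulrCA pmulr_rgt0 ?ltr0n ?fact_gt0//.
exact: bern_even_sign.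
Qed.

Lemma bernoulli_quotient i : B i.*2.+2 0 / (i.*2.+1 * i.*2.+2)%:R =
  (bern i.+1.*2).[0] * i.*2`!%:R.
Proof.
rewrite (is_bernoulli_bern hB) doubleS !factS !natrM.
have n1 : i.*2.+1%:R != 0 :> R by rewrite pnatr_eq0.
have n2 : i.*2.+2%:R != 0 :> R by rewrite pnatr_eq0.
by move: (i.*2.+1%:R : R) (i.*2.+2%:R : R) n1 n2 => x y x0 y0; field; rewrite x0 y0.
Qed.

Lemma atilde_odd0 kappa eta i : atilde B kappa eta i.*2.+2 0 = 0.
Proof. by rewrite /atilde bernoulli_odd0 !mulr0 subrr mulr0. Qed.

Lemma signr_double i : (-1) ^+ i.*2 = 1 :> R.
Proof. by rewrite -signr_odd odd_double. Qed.

Lemma atilde_even0 kappa eta i : atilde B kappa eta i.*2.+1 0 =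
  B i.*2.+2 0 / (i.*2.+1 * i.*2.+2)%:R *
  (W kappa eta i.*2.+1 - 1 -
   ((kappa * eta) ^- i.*2.+1 + (kappa * (1 - eta)) ^- i.*2.+1 +
    (eta * (1 - kappa)) ^- i.*2.+1 + ((1 - kappa) * (1 - eta)) ^- i.*2.+1)).
Proof. by rewrite /atilde /Xihat -doubleS signr_double; ring. Qed.

(** With X the sum of the inverse powers of kappa and 1 - kappa, and Y that of eta and 1 - eta, the
    bracket factors as -(X - 1)(Y - 1), and X, Y > 1. *)
Lemma odd_bracket_lt0 (kappa eta : R) m : 0 < kappa < 1 -> 0 < eta < 1 ->
  W kappa eta m.+1 - 1 -
   ((kappa * eta) ^- m.+1 + (kappa * (1 - eta)) ^- m.+1 +
    (eta * (1 - kappa)) ^- m.+1 + ((1 - kappa) * (1 - eta)) ^- m.+1) < 0.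
Proof.
move=> /andP[k0 k1] /andP[e0 e1]; rewrite /W !exprMn !invfM.
have gt1 (x : R) : 0 < x -> x < 1 -> 1 < x ^- m.+1.
  move=> x0 x1; rewrite invf_gt1 ?exprn_gt0//.
  by rewrite exprn_ilt1// ltW.
have u1 : 0 < 1 - kappa by rewrite subr_gt0.
have v1 : 0 < 1 - eta by rewrite subr_gt0.
have u2 : 1 - kappa < 1 by rewrite ltrBlDr ltrDl.
have v2 : 1 - eta < 1 by rewrite ltrBlDr ltrDl.
move: (gt1 _ k0 k1) (gt1 _ e0 e1) (gt1 _ u1 u2) (gt1 _ v1 v2).
move: (kappa ^- _) (eta ^- _) ((1 - kappa) ^- _) ((1 - eta) ^- _) => x y u v.
by move=> x1 y1 uu1 vv1; nra.
Qed.

Lemma atilde_sign (kappa eta : R) i : 0 < kappa < 1 -> 0 < eta < 1 ->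
  0 < (-1) ^+ i.+1 * atilde B kappa eta i.*2.+1 0.
Proof.
move=> hk he; rewrite atilde_even0 exprS mulN1r mulNr.
have := odd_bracket_lt0 i.*2 hk he; set Q := _ - _ => Q0.
rewrite mulrA -mulrN pmulr_rgt0 ?oppr_gt0//.
by rewrite mulrA divr_gt0 ?bernoulli_even_sign// ltr0n muln_gt0.
Qed.

(** The power of N turns inverse powers of proportions into inverse powers of counts. The function
    summed is the Laplace transform of the Taylor term of [phi] of degree 2i. *)
Lemma atilde_cell_sum p q r s i : (0 < p)%N -> (0 < q)%N -> (0 < r)%N -> (0 < s)%N ->
  (p * s = q * r)%N -> let N := (p + q + r + s)%N in
  atilde B ((p + q)%:R / N%:R) ((p + r)%:R / N%:R) i.*2.+1 0 / N%:R ^+ i.*2.+1 =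
  cell_sum p q r s
    (fun l => (bern i.+1.*2).[0] * (i.*2`!%:R / l ^+ i.*2.+1)).
Proof.
move=> p0 q0 r0 s0 psqr N; have Nn : N%:R != 0 :> R.
  by rewrite pnatr_eq0 /N -lt0n !addn_gt0 p0.
rewrite atilde_even0 bernoulli_quotient.
rewrite (cell_a _ p0 psqr) (cell_b _ p0 psqr) (cell_c _ p0 psqr) (cell_d _ p0 psqr).
rewrite /W.
have -> : 1 - (p + q)%:R / N%:R = (r + s)%:R / N%:R :> R.
  by apply: (mulIf Nn); rewrite mulrBl !divfK// mul1r /N !natrD; ring.
have -> : 1 - (p + r)%:R / N%:R = (q + s)%:R / N%:R :> R.
  by apply: (mulIf Nn); rewrite mulrBl !divfK// mul1r /N !natrD; ring.
have hV (x : R) : (x / N%:R) ^- i.*2.+1 = N%:R ^+ i.*2.+1 * x ^- i.*2.+1.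
  by rewrite expr_div_n invfM invrK mulrC.
rewrite /cell_sum !hV -/N.
have : N%:R ^+ i.*2.+1 != 0 :> R by rewrite expf_neq0.
move: (N%:R ^+ _) => x xn.
move: ((p + q)%:R ^- i.*2.+1 : R) ((r + s)%:R ^- i.*2.+1 : R) => ? ?.
move: ((p + r)%:R ^- i.*2.+1 : R) ((q + s)%:R ^- i.*2.+1 : R) => ? ?.
move: (p%:R ^- i.*2.+1 : R) (q%:R ^- i.*2.+1 : R) => ? ?.
move: (r%:R ^- i.*2.+1 : R) (s%:R ^- i.*2.+1 : R) => ? ?.
by field.
Qed.

End coefficients.

Theorem theorem6p3 (R : realType) (B : nat -> R -> R) (hB : is_bernoulli B)
    (disp : measure_display) (T : measurableType disp) (P : probability T R)
    (X : {RV P >-> R}) (N K n : nat) :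
  let kappa : R := K%:R / N%:R in
  let eta : R := n%:R / N%:R in
  let mu : R := n%:R * K%:R / N%:R in
  let a : R := kappa * eta in
  let b : R := kappa * (1 - eta) in
  let c : R := eta * (1 - kappa) in
  let d : R := (1 - kappa) * (1 - eta) in
  let L : R := ln (fine 'E_P[fun w => `|X w - mu|]
               / Num.sqrt (2 * N%:R * a * d / pi)) in
  (2 <= N)%N ->
  0 < kappa < 1 ->
  0 < eta < 1 ->
  hypergeometric X N K n ->
  mu \is a Num.int ->
  1 <= mu ->
  [/\ L%:E = (\int[lebesgue_measure]_(t in `]0%R, +oo[)
                (phi t * Delta N K n t)%:E)%E,
      forall t : R, 0 < t -> Delta N K n t < 0,
      forall j : nat, (1 <= j)%N -> atilde B kappa eta (2 * j) 0 = 0,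
      forall j : nat, (1 <= j)%N ->
        atilde B kappa eta (2 * j - 1) 0 =
          B (2 * j)%N 0 / ((2 * j - 1) * (2 * j))%:R *
          (W kappa eta (2 * j - 1) - 1
           - (a ^- (2 * j - 1) + b ^- (2 * j - 1)
              + c ^- (2 * j - 1) + d ^- (2 * j - 1)))
        /\ 0 < (-1) ^+ j * atilde B kappa eta (2 * j - 1) 0 &
      forall M : nat,
        0 < (-1) ^+ M.+1 *
            (L - \sum_(1 <= j < M.+1)
                   atilde B kappa eta (2 * j - 1) 0 / N%:R ^+ (2 * j - 1))].
Proof.
move=> kappa eta mu a b c d L N2 kappa01 eta01 hX mu_int mu1.
have N0 : (0 < N)%N by exact: ltnW.
have NR : 0 < N%:R :> R by rewrite ltr0n.
have KN : (K < N)%N.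
  by case/andP: kappa01 => _; rewrite ltr_pdivrMr// mul1r ltr_nat.
have nN : (n < N)%N.
  by case/andP: eta01 => _; rewrite ltr_pdivrMr// mul1r ltr_nat.
have [p muE] : exists p : nat, mu = p%:R.
  have /natrP : mu \is a Num.nat by rewrite natrEint mu_int (le_trans _ mu1).
  exact.
have p0 : (0 < p)%N by move: mu1; rewrite muE ler1n.
have NpE : (N * p = n * K)%N.
  apply/eqP; rewrite -(eqr_nat R) !natrM -muE /mu mulrC divfK//.
  by rewrite gt_eqF.
have [q [r [s [[q0 r0 s0] KE nE NE psqr]]]] := cell_decomposition p0 KN nN NpE.
have pn : (p <= n)%N by rewrite nE leq_addr.
have LE : L = cell_sum p q r s (@theta R).
  rewrite /L (hypergeometric_expectation mu (ltnW KN) (ltnW nN) hX) muE.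
  rewrite (hyp_mean_deviation N0 (ltnW KN) pn); last by rewrite -muE.
  rewrite /a /d /kappa /eta NE KE nE; exact: ln_mean_deviation.
have intL : has_integral (fun t => phi t * Delta N K n t) L.
  rewrite LE NE KE nE; apply: has_integral_cell_sum => // l l0.
  exact: (theta_spec l0).1.
have D0 t : 0 < t -> Delta N K n t < 0 :> R.
  by rewrite NE KE nE; exact: Delta_lt0.
split=> //; first by have [_ ->] := intL.
- by case=> [//|i] _; rewrite (_ : 2 * i.+1 = i.*2.+2)%N ?atilde_odd0//; lia.
- case=> [//|i] _.
  rewrite (_ : 2 * i.+1 - 1 = i.*2.+1)%N; last by lia.
  rewrite (_ : 2 * i.+1 = i.*2.+2)%N; last by lia.
  split; first exact: atilde_even0.
  exact: atilde_sign.
move=> M.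
pose c2 j : R := (bern j.*2).[0].
(* Stated for every j; at j = 0 the predecessor is 0 and the value is irrelevant, as the sums start
   at 1. *)
have moment j : has_integral (fun t => c2 j * t ^+ (j.-1).*2 * Delta N K n t)
    (cell_sum p q r s (fun l => c2 j * ((j.-1).*2`!%:R / l ^+ (j.-1).*2.+1))).
  rewrite NE KE nE; apply: has_integral_cell_sum => // l l0.
  apply: has_integral_ext (has_integralZ (c2 j) (has_integral_monomial_exp (j.-1).*2 l0)).
  by move=> t _; rewrite mulrA.
have -> : \sum_(1 <= j < M.+1) atilde B kappa eta (2 * j - 1) 0 / N%:R ^+ (2 * j - 1) =
    \sum_(1 <= j < M.+1)
      cell_sum p q r s (fun l => c2 j * ((j.-1).*2`!%:R / l ^+ (j.-1).*2.+1)).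
  apply: eq_big_nat => -[//|i] _.
  rewrite (_ : 2 * i.+1 - 1 = i.*2.+1)%N; last by lia.
  by rewrite /kappa /eta NE KE nE; exact: atilde_cell_sum.
(* The integrand is the remainder with sign (-1)^M, positive by [phi_sign], times [- Delta], also
   positive; this is where the extra sign in (-1)^(M+1) comes from. *)
have intM := has_integralZ ((-1) ^+ M.+1)
  (has_integralB intL (has_integral_sum 1 M.+1 moment)).
apply: has_integral_gt0 intM => t t0.
rewrite -mulr_suml -mulrBl mulrA exprS mulN1r mulNr mulNr -mulrN pmulr_rgt0.
  by rewrite oppr_gt0 D0.
exact: phi_sign.
Qed.
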